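(* For every $n\in\mathbb{N}$ with $n>1$, put $d=415+160n$. Then there is a functorial semi-norm $|\cdot|$ on singular homology in degree $d$ that is positive and finite on certain homology classes of simply connected spaces; that is, there exist a simply connected space $X$ and a class $\alpha\in H_d(X;\mathbb{R})$ with $0<|\alpha|<\infty$.
   Context: A functorial semi-norm on singular homology in degree $d$ is a choice, for every topological space $X$, of a semi-norm $|\cdot|:H_d(X;\mathbb{R})\to[0,\infty]$ (the value $\infty$ being allowed; semi-norm means $|0|=0$, $|c\alpha|=|c|\,|\alpha|$ for all real $c\neq0$, and the triangle inequality) such that $|f_*(\alpha)|\le|\alpha|$ for every continuous map $f:X\to Y$ and every $\alpha\in H_d(X;\mathbb{R})$. *)

(* Defs.v *)
From HB Require Import structures.
From mathcomp Require Import all_boot all_order all_algebra.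
From mathcomp Require Import generic_quotient ring_quotient.
From mathcomp Require Import all_classical all_reals.
From mathcomp Require Import topology ereal normedtype continuous_path.
From mathcomp Require Import freeg zify.

Set Implicit Arguments.
Unset Strict Implicit.
Unset Printing Implicit Defensive.

Import Order.TTheory GRing.Theory Num.Theory.
Import numFieldNormedType.Exports.

Local Open Scope classical_set_scope.
Local Open Scope quotient_scope.
Local Open Scope ring_scope.

Section FreegLinear.
Context {R : nzRingType} {K : choiceType} {M : lmodType R}.

Lemma fglift_is_linear (f : K -> M) : linear (fglift f).
Proof.
pose g := fglift f.
have gB : {morph g : x y / x - y} := lift_is_additive f.
pose gA := GRing.isZmodMorphism.Build _ _ g gB.
pose G : {additive {freeg K / R} -> M} := HB.pack g gA.
have gZ a D : g (a *: D) = a *: g D.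
  rewrite -{2}(freeg_sumE D) /GRing.scale /= /fgscale.
  rewrite -[g]/(G : _ -> _) !raddf_sum -/(GRing.scale _ _) scaler_sumr.
  by apply: eq_bigr => x _; rewrite /= /g !liftU scalerA.
move=> a x y; rewrite -gZ -[g]/(G : _ -> _); exact: (raddfD G).
Qed.

HB.instance Definition _ (f : K -> M) :=
  GRing.isLinear.Build R {freeg K / R} M *:%R (fglift f) (fglift_is_linear f).

Lemma freeg_linear_ext (f g : {linear {freeg K / R} -> M}) :
  (forall k, f << k >> = g << k >>) -> f =1 g.
Proof.
move=> fg D; rewrite -(freeg_sumE D) !linear_sum; apply: eq_bigr => k _.
suff -> : << coeff k D *g k >> = coeff k D *: << k >> :> {freeg K / R}.
  by rewrite !linearZ /= fg.
by apply/eqP/freeg_eqP => x; rewrite coeffZ !coeffU mul1r.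
Qed.

End FreegLinear.

Section SingularChains.
Context {R : realType}.

Definition std_simplex (n : nat) : set 'rV[R]_n.+1 :=
  [set t | (forall i, 0 <= t ord0 i) /\ \sum_i t ord0 i = 1].
Arguments std_simplex : clear implicits.

(* Embeds the standard simplex as the face opposite the i-th vertex: a zero is
   inserted as i-th barycentric coordinate. *)
Definition face_row n (i : 'I_n.+2) (t : 'rV[R]_n.+1) : 'rV[R]_n.+2 :=
  \row_j (if unlift i j is Some k then t ord0 k else 0).

Lemma face_row_simplex n (i : 'I_n.+2) (t : std_simplex n) :
  std_simplex n.+1 (face_row i (\val t)).
Proof.
case: t => t /= /set_mem[t0 t1]; split=> [j|].
  by rewrite mxE; case: unlift.
rewrite (bigD1_ord i) //= mxE unlift_none add0r -[RHS]t1.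
by apply: eq_bigr => j _; rewrite mxE liftK.
Qed.

Definition face n (i : 'I_n.+2) (t : std_simplex n) : std_simplex n.+1 :=
  SigSub (mem_set (face_row_simplex i t)).

Lemma continuous_mx (T : topologicalType) m n (f : T -> 'M[R]_(m, n)) :
  (forall i j, continuous (fun x => f x i j)) -> continuous f.
Proof.
move=> cf x A [P sP PA]; apply: filterS PA _.
apply: filter_forall => i; apply: filter_forall => j.
exact: cf.
Qed.

Lemma face_continuous n (i : 'I_n.+2) : continuous (face i).
Proof.
apply: continuous_comp_initial; apply: continuous_mx => k j.
have -> : (fun x => (set_val \o face i) x k j) =
    (if unlift i j is Some l then (fun s : 'rV[R]_n.+1 => s ord0 l)
     else cst 0) \o (set_val : std_simplex n -> 'rV[R]_n.+1).
  by apply/funext => -[t ht] /=; rewrite set_valE /= mxE; case: unlift.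
move=> t; apply: continuous_comp; first exact: initial_continuous.
case: unlift => [l|]; last exact: cst_continuous.
exact: coord_continuous.
Qed.

HB.instance Definition _ n (i : 'I_n.+2) :=
  isContinuous.Build _ _ (face i) (@face_continuous n i).

Definition singular_simplex (X : topologicalType) (n : nat) :=
  continuousType (std_simplex n) X.

HB.instance Definition _ X n := Choice.on (singular_simplex X n).

Definition chain (X : topologicalType) (n : nat) : Type :=
  {freeg (singular_simplex X n) / R}.

HB.instance Definition _ X n := GRing.Lmodule.on (chain X n).

Definition boundary_succ (X : topologicalType) (n : nat) :
    chain X n.+1 -> chain X n :=
  fglift (fun s : singular_simplex X n.+1 =>
    \sum_(i < n.+2) (-1) ^+ i *: << (s \o face i : singular_simplex X n) >>
    : chain X n).

HB.instance Definition _ X n := GRing.Linear.on (@boundary_succ X n).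

(* In degree 0 the target [chain X 0.-1] is [chain X 0], and the map is 0, so
   that every 0-chain is a cycle. *)
Definition boundary (X : topologicalType) (n : nat) :
    chain X n -> chain X n.-1 :=
  match n with 0 => fun=> 0 | m.+1 => @boundary_succ X m end.

Lemma boundary_linear (X : topologicalType) n : linear (@boundary X n).
Proof.
case: n => [|n] a x y /=; first by rewrite scaler0 addr0.
exact: linearP.
Qed.

HB.instance Definition _ X n := GRing.isLinear.Build R (chain X n)
  (chain X n.-1) *:%R (@boundary X n) (@boundary_linear X n).

Definition chain_map (X Y : topologicalType) (f : continuousType X Y) (n : nat) :
    chain X n -> chain Y n :=
  fglift (fun s : singular_simplex X n =>
    << (f \o s : singular_simplex Y n) >> : chain Y n).

HB.instance Definition _ X Y f n := GRing.Linear.on (@chain_map X Y f n).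

Lemma boundary_chain_map (X Y : topologicalType) (f : continuousType X Y) n (c : chain X n) :
  boundary (chain_map f c) = chain_map f (boundary c).
Proof.
case: n c => [|n] c /=; first by rewrite raddf0.
apply: (freeg_linear_ext (f := @boundary_succ Y n \o @chain_map X Y f n.+1)
  (g := @chain_map X Y f n \o @boundary_succ X n)) c => s /=.
rewrite /chain_map /boundary_succ !liftU !scale1r !liftU scale1r.
rewrite [RHS]raddf_sum; apply: eq_bigr => i _.
rewrite [RHS]linearZ /=.
rewrite liftU scale1r; congr (_ *: << _ >>).
by apply/continuousEP.
Qed.


Lemma face_rowC n (i j' : 'I_n.+3) (j i' : 'I_n.+2) (t : 'rV[R]_n.+1) :
  (j < i)%N -> j' = j :> nat -> i = i'.+1 :> nat ->
  face_row i (face_row j t) = face_row j' (face_row i' t).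
Proof.
move=> ji jj' ii'; apply/rowP => k; rewrite !mxE.
case: unliftP => [l /(congr1 val) kl|/(congr1 val) kl];
  case: unliftP => [l' /(congr1 val) kl'|/(congr1 val) kl']; rewrite ?mxE //;
  rewrite /= /bump in kl kl'.
- case: unliftP => [m /(congr1 val) lm|/(congr1 val) lm];
    case: unliftP => [m' /(congr1 val) lm'|/(congr1 val) lm'] //;
    rewrite /= /bump in lm lm'; try lia.
  by congr (t _ _); apply/val_inj => /=; lia.
- case: unliftP => [m /(congr1 val) lm|//]; rewrite /= /bump in lm; lia.
- case: unliftP => [m /(congr1 val) lm|//]; rewrite /= /bump in lm; lia.
Qed.

Lemma boundaryK (X : topologicalType) n (c : chain X n) :
  boundary (boundary c) = 0.
Proof.
case: n c => [|[|n]] c //.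
apply: (freeg_linear_ext (f := @boundary_succ X n \o @boundary_succ X n.+1)
  (g := \0)) c => s.
rewrite [LHS]/=.
have -> : @boundary_succ X n.+1 << s >> =
    \sum_(i < n.+3) (-1) ^+ i *: << (s \o face i : singular_simplex X n.+1) >>.
  by rewrite /boundary_succ liftU scale1r.
rewrite linear_sum /=.
pose G (p : 'I_n.+3 * 'I_n.+2) : chain X n := (-1) ^+ (p.1 + p.2) *:
  << ((s \o face p.1) \o face p.2 : singular_simplex X n) >>.
have -> : \sum_(i < n.+3) @boundary_succ X n ((-1) ^+ i *:
    << (s \o face i : singular_simplex X n.+1) >>) = \sum_p G p.
  have -> : \sum_p G p = \sum_i \sum_j G (i, j).
    by rewrite pair_bigA; apply: eq_bigr => -[].
  apply: eq_bigr => i _.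
  rewrite linearZ /= /boundary_succ liftU scale1r scaler_sumr.
  by apply: eq_bigr => j _; rewrite scalerA -exprD.
pose h (p : 'I_n.+3 * 'I_n.+2) : 'I_n.+3 * 'I_n.+2 :=
  if (p.2 < p.1)%N then (inord p.2, inord p.1.-1) else (inord p.2.+1, inord p.1).
have hK : involutive h.
  move=> [i j]; have ile := ltn_ord i; have jle := ltn_ord j.
  rewrite /h /=; case: (ltnP j i) => ij /=.
    rewrite !inordK //=; try lia; rewrite ifF; last lia.
    by congr (_, _); apply/val_inj; rewrite /= inordK //; lia.
  rewrite !inordK //=; try lia; rewrite ifT; last lia.
  by congr (_, _); apply/val_inj; rewrite /= inordK //; lia.
have Gh (p : 'I_n.+3 * 'I_n.+2) : (p.2 < p.1)%N -> G (h p) = - G p.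
  move=> p21; rewrite /h p21 /G /=.
  have p1 := ltn_ord p.1; have p2 := ltn_ord p.2.
  have -> : ((inord p.2 : 'I_n.+3) + (inord p.1.-1 : 'I_n.+2) = (p.1 + p.2).-1)%N.
    by rewrite !inordK; lia.
  rewrite -scaleNr -[- (_ ^+ _)]mulN1r -exprS.
  have -> : (-1) ^+ (p.1 + p.2).+1 = (-1) ^+ (p.1 + p.2).-1 :> R.
    have -> : ((p.1 + p.2).+1 = (p.1 + p.2).-1 + 2)%N by lia.
    by rewrite exprD sqrrN expr1n mulr1.
  congr (_ *: << _ >>); apply/continuousEP => t /=; congr (s _).
  by apply/val_inj; apply/esym/face_rowC; rewrite ?inordK //; lia.
have Gh' (p : 'I_n.+3 * 'I_n.+2) : G (h p) = - G p.
  case: (ltnP p.2 p.1) => [|p12]; first exact: Gh.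
  rewrite -[in RHS](hK p) [in RHS]Gh ?opprK// /h [(p.2 < p.1)%N]ltnNge p12 /=.
  have p1 := ltn_ord p.1; have p2 := ltn_ord p.2.
  by rewrite !inordK; lia.
have : \sum_p G p = - \sum_p G p.
  rewrite -sumrN [LHS](reindex_inj (inv_inj hK)).
  by apply: eq_bigr => p _; rewrite Gh'.
move/eqP; rewrite -subr_eq0 opprK -mulr2n -scaler_nat scaler_eq0.
by rewrite pnatr_eq0 => /eqP.
Qed.

Definition is_cycle (X : topologicalType) n : pred (chain X n) :=
  fun c => boundary c == 0.

Lemma is_cycle_submod (X : topologicalType) n : submod_closed (@is_cycle X n).
Proof.
split=> [|a x y]; first by rewrite /in_mem /= /is_cycle linear0.
rewrite /in_mem /= /is_cycle linearP /= => /eqP-> /eqP->.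
by rewrite scaler0 addr0.
Qed.

HB.instance Definition _ (X : topologicalType) n :=
  GRing.isSubmodClosed.Build R (chain X n) (@is_cycle X n)
    (@is_cycle_submod X n).

Record cycle (X : topologicalType) n :=
  Cycle { cycle_val :> chain X n ; _ : cycle_val \in @is_cycle X n }.

HB.instance Definition _ (X : topologicalType) n :=
  [isSub for @cycle_val X n].
HB.instance Definition _ (X : topologicalType) n :=
  [Choice of cycle X n by <:].
HB.instance Definition _ (X : topologicalType) n :=
  [SubChoice_isSubLmodule of cycle X n by <:].

Definition is_boundary (X : topologicalType) n : pred (cycle X n) :=
  fun z => `[< exists b : chain X n.+1, boundary b = cycle_val z >].

Lemma is_boundary_submod (X : topologicalType) n :
  submod_closed (@is_boundary X n).
Proof.
split=> [|a x y]; first by apply/asboolP; exists 0; rewrite linear0.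
move=> /asboolP[b bx] /asboolP[c cy]; apply/asboolP.
by exists (a *: b + c); rewrite [LHS]linearP /= -bx -cy.
Qed.

HB.instance Definition _ (X : topologicalType) n :=
  GRing.isSubmodClosed.Build R (cycle X n) (@is_boundary X n)
    (@is_boundary_submod X n).

Definition boundaries (X : topologicalType) n : zmodClosed (cycle X n) :=
  GRing.ZmodClosed.clone (cycle X n) (@is_boundary X n) _.

Definition homology (X : topologicalType) n : Type :=
  Quotient.quot (boundaries X n).

HB.instance Definition _ (X : topologicalType) n :=
  GRing.Zmodule.on (homology X n).
HB.instance Definition _ (X : topologicalType) n :=
  Quotient.on (homology X n).

Definition homology_class (X : topologicalType) n (z : cycle X n) :
  homology X n := \pi z.

Lemma homology_classP (X : topologicalType) n (z w : cycle X n) :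
  homology_class z = homology_class w <->
  exists b : chain X n.+1, boundary b = cycle_val z - cycle_val w.
Proof.
rewrite /homology_class; split=> [/eqP|bzw].
  by rewrite -Quotient.idealrBE => /asboolP.
by apply/eqP; rewrite -Quotient.idealrBE; apply/asboolP.
Qed.

Lemma homology_classK (X : topologicalType) n (a : homology X n) :
  homology_class (repr a) = a.
Proof. exact: reprK. Qed.

Lemma homology_classD (X : topologicalType) n :
  {morph @homology_class X n : z w / z + w}.
Proof. by move=> z w; rewrite /homology_class !piE. Qed.

Definition homology_scale (X : topologicalType) n (c : R) (a : homology X n) :
  homology X n := homology_class (c *: repr a).

Lemma homology_classZ (X : topologicalType) n c (z : cycle X n) :
  homology_class (c *: z) = homology_scale c (homology_class z).
Proof.
have /homology_classP[b bz] := homology_classK (homology_class z).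
apply/homology_classP; exists (- c *: b).
transitivity (- c *: boundary b); first exact: linearZ.
by rewrite bz scaleNr scalerBr opprB.
Qed.

Lemma homology_scaleA (X : topologicalType) n c e (a : homology X n) :
  homology_scale c (homology_scale e a) = homology_scale (c * e) a.
Proof.
by rewrite -(homology_classK a) -!homology_classZ scalerA.
Qed.

Lemma homology_scale1 (X : topologicalType) n :
  left_id 1 (@homology_scale X n).
Proof.
by move=> a; rewrite -(homology_classK a) -homology_classZ scale1r.
Qed.

Lemma homology_scaleDr (X : topologicalType) n :
  right_distributive (@homology_scale X n) +%R.
Proof.
move=> c a b; rewrite -(homology_classK a) -(homology_classK b).
by rewrite -homology_classD -!homology_classZ -homology_classD scalerDr.
Qed.

Lemma homology_scaleDl (X : topologicalType) n (a : homology X n) :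
  {morph (@homology_scale X n)^~ a : c e / c + e}.
Proof.
move=> c e; rewrite -(homology_classK a).
by rewrite -!homology_classZ -homology_classD scalerDl.
Qed.

HB.instance Definition _ (X : topologicalType) n :=
  GRing.Zmodule_isLmodule.Build R (homology X n)
    (@homology_scaleA X n) (@homology_scale1 X n)
    (@homology_scaleDr X n) (@homology_scaleDl X n).

Lemma homology_class_linear (X : topologicalType) n :
  linear (@homology_class X n).
Proof. by move=> c z w; rewrite homology_classD homology_classZ. Qed.

HB.instance Definition _ (X : topologicalType) n :=
  GRing.isLinear.Build R (cycle X n) (homology X n) *:%R
    (@homology_class X n) (@homology_class_linear X n).

Lemma chain_map_cycle (X Y : topologicalType) (f : continuousType X Y) n
    (z : cycle X n) :
  chain_map f (cycle_val z) \in @is_cycle Y n.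
Proof.
case: z => c /eqP /= bc.
by apply/eqP; rewrite boundary_chain_map bc linear0.
Qed.

Definition cycle_map (X Y : topologicalType) (f : continuousType X Y) n
  (z : cycle X n) : cycle Y n := Cycle (chain_map_cycle f z).

(* The value does not depend on the representative: see [homology_map_class]. *)
Definition homology_map (X Y : topologicalType) (f : continuousType X Y) n
  (a : homology X n) : homology Y n := homology_class (cycle_map f (repr a)).

Lemma homology_map_class (X Y : topologicalType) (f : continuousType X Y) n
    (z : cycle X n) :
  homology_map f (homology_class z) = homology_class (cycle_map f z).
Proof.
have /homology_classP[b bz] := homology_classK (homology_class z).
apply/homology_classP; exists (chain_map f b).
by rewrite boundary_chain_map bz linearB.
Qed.

Lemma homology_map_linear (X Y : topologicalType) (f : continuousType X Y) n :
  linear (@homology_map X Y f n).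
Proof.
move=> c a b; rewrite -(homology_classK a) -(homology_classK b) -linearP.
rewrite !homology_map_class -linearP; congr homology_class.
by apply/val_inj; rewrite /= linearP.
Qed.

HB.instance Definition _ (X Y : topologicalType) (f : continuousType X Y) n :=
  GRing.isLinear.Build R (homology X n) (homology Y n) *:%R
    (@homology_map X Y f n) (@homology_map_linear X Y f n).

Lemma homology_map_id (X : topologicalType) n (a : homology X n) :
  homology_map idfun a = a.
Proof.
rewrite -(homology_classK a) homology_map_class; congr homology_class.
apply/val_inj => /=.
apply: (freeg_linear_ext (f := @chain_map X X idfun n) (g := idfun)) => s /=.
by rewrite /chain_map liftU scale1r; congr << _ >>; apply/continuousEP.
Qed.

Lemma homology_map_comp (X Y Z : topologicalType) (f : continuousType X Y)
    (g : continuousType Y Z) n (a : homology X n) :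
  homology_map (g \o f) a = homology_map g (homology_map f a).
Proof.
rewrite -(homology_classK a) !homology_map_class; congr homology_class.
apply/val_inj => /=.
apply: (freeg_linear_ext (f := @chain_map X Z (g \o f) n)
  (g := @chain_map Y Z g n \o @chain_map X Y f n)) => s /=.
rewrite /chain_map !liftU !scale1r liftU scale1r.
by congr << _ >>; apply/continuousEP.
Qed.

End SingularChains.

Arguments homology : clear implicits.

Record functorial_seminorm (R : realType) (d : nat) := FunctorialSeminorm {
  seminorm :> forall X : topologicalType, homology R X d -> \bar R;
  seminorm_ge0 : forall X (a : homology R X d), (0 <= seminorm a)%E;
  seminorm0 : forall X, seminorm (0 : homology R X d) = 0%E;
  seminormZ : forall X (c : R) (a : homology R X d), c != 0 ->
    seminorm (c *: a) = (`|c|%:E * seminorm a)%E;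
  seminormD : forall X (a b : homology R X d),
    (seminorm (a + b)%R <= seminorm a + seminorm b)%E;
  seminorm_map : forall (X Y : topologicalType) (f : continuousType X Y)
    (a : homology R X d), (seminorm (homology_map f a) <= seminorm a)%E
}.

Definition unit_interval (R : realType) : Type :=
  [set t : R | 0 <= t <= 1].

HB.instance Definition _ (R : realType) :=
  Topological.on (unit_interval R).

Section UnitInterval.
Context {R : realType}.

Lemma unit_interval0 : [set t : R | 0 <= t <= 1] 0.
Proof. by rewrite /= lexx ler01. Qed.

Lemma unit_interval1 : [set t : R | 0 <= t <= 1] 1.
Proof. by rewrite /= lexx ler01. Qed.

Let i0 : unit_interval R := SigSub (mem_set unit_interval0).
Let i1 : unit_interval R := SigSub (mem_set unit_interval1).

Lemma unit_interval_neq : i0 != i1.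
Proof. by apply/eqP => /(congr1 val)/eqP /=; rewrite eq_sym oner_eq0. Qed.

HB.instance Definition _ := isBiPointed.Build (unit_interval R)
  unit_interval_neq.

End UnitInterval.

(* Path-connected spaces are required to be nonempty. *)
Definition path_connected (R : realType) (X : topologicalType) :=
  inhabited X /\
  forall x y : X, inhabited {path (unit_interval R) from x to y}.

(* Homotopy relative to the end points. *)
Definition path_homotopic (R : realType) (X : topologicalType) (x y : X)
    (p q : {path (unit_interval R) from x to y}) :=
  exists H : continuousType (unit_interval R * unit_interval R)%type X,
    [/\ forall s, H (s, zero) = p s, forall s, H (s, one) = q s,
        forall t, H (zero, t) = x & forall t, H (one, t) = y].

(* The second condition is the triviality of all fundamental groups. *)
Definition simply_connected (R : realType) (X : topologicalType) :=
  path_connected R X /\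
  forall (x : X) (p : {path (unit_interval R) from x to x}),
    path_homotopic p (cst x).

(* Main.v *)
From HB Require Import structures.
Require Import Defs.
From mathcomp Require Import all_boot all_order all_algebra.
From mathcomp Require Import all_classical all_reals.
From mathcomp Require Import topology ereal normedtype sequences continuous_path.
From mathcomp Require Import freeg lra zify.

(** A finite space Y has finitely many self-maps.  Hence, for every linear form
    phi on H_d(Y), the supremum of |phi (f_* a)| over all maps f : X -> Y is a
    functorial semi-norm that is finite on H_d(Y), and it is positive at a as
    soon as phi a <> 0.

    Take for Y the poset of proper nonempty subsets of a set of d + 2 labels, a
    finite simply connected model of the d-sphere.  The form phi is a degree:
    label each point of Y by one of its elements, subdivide the simplices of a
    cycle barycentrically N times, and add up the signs of those small simplices
    whose vertices carry all labels but 0.  For large N every small simplex lies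
    in a set of points whose images miss a common label, so the coboundary of the
    sign cochain vanishes there; therefore the sum is eventually constant in N
    and depends on the homology class only.  On the boundary of the standard
    simplex, mapped to Y by taking the set of large coordinates, it equals 1. *)

Set Implicit Arguments.
Unset Strict Implicit.
Unset Printing Implicit Defensive.

Import Order.TTheory GRing.Theory Num.Theory.
Import numFieldNormedType.Exports.

Local Open Scope classical_set_scope.
Local Open Scope ring_scope.

(** * Augmented chains on lists of points and barycentric subdivision *)

Section ListChains.
Context {R : realType} {V : lmodType R}.

Local Notation L := {freeg (seq V) / R}.

Definition join_vertex (v : V) : L -> L := fglift (fun s => << v :: s >> : L).
HB.instance Definition _ v := GRing.Linear.on (join_vertex v).

(* The empty list is a simplex of dimension -1, with [list_faces [:: v] = << [::] >>]:
   the complex of lists is augmented, so that [bd_join] has no exception. *)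
Fixpoint list_faces (s : seq V) : L :=
  if s is v :: s' then << s' >> - join_vertex v (list_faces s') else 0.

Definition bd : L -> L := fglift list_faces.
HB.instance Definition _ := GRing.Linear.on bd.

Lemma join_vertexU v s : join_vertex v << s >> = << v :: s >>.
Proof. by rewrite /join_vertex liftU scale1r. Qed.

Lemma bdU s : bd << s >> = list_faces s.
Proof. by rewrite /bd liftU scale1r. Qed.

Lemma bd_join v c : bd (join_vertex v c) = c - join_vertex v (bd c).
Proof.
pose G : {linear L -> L} := idfun \- (join_vertex v \o bd).
apply: (freeg_linear_ext (f := bd \o join_vertex v) (g := G)) => s /=.
by rewrite /= join_vertexU !bdU.
Qed.

Lemma bdK c : bd (bd c) = 0.
Proof.
apply: (freeg_linear_ext (f := bd \o bd) (g := \0)) => s /=.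
rewrite bdU; elim: s => [|v s IH] /=; first by rewrite linear0.
by rewrite linearB /= bd_join IH linear0 subr0 bdU subrr.
Qed.

Definition barycenter (s : seq V) : V := (size s)%:R^-1 *: \sum_(x <- s) x.

(* Barycentric subdivision, meant for lists of size [n]; the chain map and
   homotopy identities below hold for all chains nevertheless. *)
Fixpoint subdivide n : {linear L -> L} :=
  if n is n'.+1 then
    fglift (fun s => join_vertex (barycenter s) (subdivide n' (list_faces s)))
  else idfun.

Fixpoint subdivide_htpy n : {linear L -> L} :=
  if n is n'.+1 then
    fglift (fun s =>
      join_vertex (barycenter s) (<< s >> - subdivide_htpy n' (list_faces s)))
  else \0.

Lemma subdivideU n s : subdivide n.+1 << s >> =
  join_vertex (barycenter s) (subdivide n (list_faces s)).
Proof. by rewrite /= liftU scale1r. Qed.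

Lemma subdivide_htpyU n s : subdivide_htpy n.+1 << s >> =
  join_vertex (barycenter s) (<< s >> - subdivide_htpy n (list_faces s)).
Proof. by rewrite /= liftU scale1r. Qed.

(** The boundary of a cone is its base minus the cone over the boundary of the base. Here the base
    is the subdivision of [bd << s >>], whose boundary is by induction the subdivision of
    [bd (bd << s >>) = 0], so only the base remains. *)
Lemma bd_subdivide n c : bd (subdivide n.+1 c) = subdivide n (bd c).
Proof.
elim: n c => [|n IH] c.
  apply: (freeg_linear_ext (f := bd \o subdivide 1) (g := bd)) => s.
  change (bd (subdivide 1 << s >>) = bd << s >>).
  rewrite subdivideU bd_join bdU.
  by rewrite /= -bdU bdK linear0 subr0.
apply: (freeg_linear_ext (f := bd \o subdivide n.+2)
  (g := subdivide n.+1 \o bd)) => s.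
change (bd (subdivide n.+2 << s >>) = subdivide n.+1 (bd << s >>)).
rewrite subdivideU bd_join bdU.
by rewrite -bdU IH bdK !linear0 addr0.
Qed.

(** The base of the cone is [s] minus the homotopy of its faces; by induction its boundary is the
    subdivision of [bd << s >>], and the cone over that is the subdivision of [s] itself. *)
Lemma bd_subdivide_htpy n c : bd (subdivide_htpy n.+1 c) =
  c - subdivide n.+1 c - subdivide_htpy n (bd c).
Proof.
elim: n c => [|n IH] c.
  pose G : {linear L -> L} := idfun \- subdivide 1.
  rewrite [X in _ - X]/= subr0.
  apply: (freeg_linear_ext (f := bd \o subdivide_htpy 1) (g := G)) => s.
  change (bd (subdivide_htpy 1 << s >>) = G << s >>).
  rewrite subdivide_htpyU bd_join [X in _ - X]/= subr0.
  by rewrite /= liftU scale1r bdU.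
pose G : {linear L -> L} :=
  (idfun \- subdivide n.+2) \- (subdivide_htpy n.+1 \o bd).
apply: (freeg_linear_ext (f := bd \o subdivide_htpy n.+2) (g := G)) => s.
have -> : G << s >> = << s >> - subdivide n.+2 << s >>
  - subdivide_htpy n.+1 (bd << s >>) by [].
change (bd (subdivide_htpy n.+2 << s >>) = G << s >>).
rewrite subdivide_htpyU bd_join linearB /= -bdU IH bdK.
rewrite linear0 subr0 opprB addrCA subrr addr0.
by rewrite [in RHS]liftU scale1r -!bdU [in RHS]addrAC.
Qed.

Lemma bd_iter_subdivide n N c : bd (iter N (subdivide n.+1) c) =
  iter N (subdivide n) (bd c).
Proof. by elim: N => //= N IH; rewrite -IH -bd_subdivide. Qed.

(** An inductive form of membership in a linear span: properties of subdivided chains are tracked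
    without looking at supports or cancellations. *)
Inductive spanned (P : seq V -> Prop) : L -> Prop :=
| spanned0 : spanned P 0
| spannedDZ a s c : P s -> spanned P c -> spanned P (a *: << s >> + c).

Lemma spannedP P a x y : spanned P x -> spanned P y -> spanned P (a *: x + y).
Proof.
elim=> [|b s c Ps _ IH] Py; first by rewrite scaler0 add0r.
by rewrite scalerDr scalerA -addrA; apply: spannedDZ => //; apply: IH.
Qed.

Lemma spannedU P s : P s -> spanned P << s >>.
Proof.
by move=> Ps; rewrite -[X in spanned _ X]scale1r -[X in spanned _ X]addr0;
  apply: spannedDZ => //; apply: spanned0.
Qed.

Lemma spannedB P x y : spanned P x -> spanned P y -> spanned P (x - y).
Proof. by move=> Px Py; rewrite addrC -scaleN1r; apply: spannedP. Qed.

Lemma spanned_linear P Q (f : {linear L -> L}) c :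
  (forall s, P s -> spanned Q (f << s >>)) -> spanned P c -> spanned Q (f c).
Proof.
move=> PQ; elim=> [|a s x Ps _ IH]; first by rewrite linear0; apply: spanned0.
by rewrite linearP; apply: spannedP => //; apply: PQ.
Qed.

Lemma spanned_eq0 P (f : {linear L -> R^o}) c :
  (forall s, P s -> f << s >> = 0) -> spanned P c -> f c = 0.
Proof.
move=> P0; elim=> [|a s x Ps _ IH]; first by rewrite linear0.
by rewrite linearP /= IH P0 // scaler0 addr0.
Qed.

Lemma spanned_sub (P Q : seq V -> Prop) c :
  (forall s, P s -> Q s) -> spanned P c -> spanned Q c.
Proof.
move=> PQ; elim=> [|a s x Ps _ IH]; first exact: spanned0.
by apply: spannedDZ => //; apply: PQ.
Qed.

Lemma list_faces_spanned s : spanned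
  (fun t => (size t).+1 = size s /\ {subset t <= s}) (list_faces s).
Proof.
elim: s => [|v s IH] /=; first exact: spanned0.
apply: spannedB.
  by apply: spannedU; split=> // x; rewrite inE => ->; rewrite orbT.
apply: spanned_linear IH => t [st ts]; rewrite /= join_vertexU.
apply: spannedU; split=> [|x]; rewrite /= ?st// !inE.
by case/predU1P=> [->|/ts ->]; rewrite ?eqxx ?orbT.
Qed.

End ListChains.

(** * Naturality of subdivision under linear maps *)

Section ListChainsMap.
Context {R : realType} {V W : lmodType R} (f : {linear V -> W}).

Local Notation LV := {freeg (seq V) / R}.
Local Notation LW := {freeg (seq W) / R}.

Definition map_list : LV -> LW := fglift (fun s => << map f s >> : LW).
HB.instance Definition _ := GRing.Linear.on map_list.

Lemma map_listU s : map_list << s >> = << map f s >>.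
Proof. by rewrite /map_list liftU scale1r. Qed.

Lemma map_list_join v c :
  map_list (join_vertex v c) = join_vertex (f v) (map_list c).
Proof.
apply: (freeg_linear_ext (f := map_list \o join_vertex v)
  (g := join_vertex (f v) \o map_list)) => s /=.
by rewrite join_vertexU !map_listU join_vertexU.
Qed.

Lemma map_list_faces s : map_list (list_faces s) = list_faces (map f s).
Proof.
elim: s => [|v s IH] /=; first by rewrite linear0.
by rewrite linearB /= map_listU map_list_join IH.
Qed.

Lemma barycenter_map s : f (barycenter s) = barycenter (map f s).
Proof. by rewrite /barycenter linearZ size_map big_map linear_sum. Qed.

Lemma map_list_subdivide n c :
  map_list (subdivide n c) = subdivide n (map_list c).
Proof.
elim: n c => [|n IH] c //.
apply: (freeg_linear_ext (f := map_list \o subdivide n.+1)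
  (g := subdivide n.+1 \o map_list)) => s.
change (map_list (subdivide n.+1 << s >>) = subdivide n.+1 (map_list << s >>)).
rewrite map_listU !subdivideU map_list_join IH.
by rewrite barycenter_map map_list_faces.
Qed.

Lemma map_list_iter_subdivide n N c :
  map_list (iter N (subdivide n) c) = iter N (subdivide n) (map_list c).
Proof. by elim: N => //= N IH; rewrite map_list_subdivide IH. Qed.

Lemma map_list_subdivide_htpy n c :
  map_list (subdivide_htpy n c) = subdivide_htpy n (map_list c).
Proof.
elim: n c => [|n IH] c; first by rewrite /= linear0.
apply: (freeg_linear_ext (f := map_list \o subdivide_htpy n.+1)
  (g := subdivide_htpy n.+1 \o map_list)) => s.
change (map_list (subdivide_htpy n.+1 << s >>) =
  subdivide_htpy n.+1 (map_list << s >>)).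
rewrite map_listU !subdivide_htpyU map_list_join.
by rewrite [map_list (_ - _)]linearB /= IH barycenter_map map_list_faces map_listU.
Qed.

End ListChainsMap.

(** * Mesh of iterated barycentric subdivisions *)

Definition simplex_in (V : eqType) n (K : set V) (s : seq V) :=
  size s = n /\ {in s, forall x, K x}.

Section Mesh.
Context {R : realType} {V : normedModType R}.
Implicit Types (K : set V) (s : seq V) (r : R).

Local Notation L := {freeg (seq V) / R}.

(* Replaces convexity: subdivision only ever forms barycenters. *)
Definition bary_closed K :=
  forall s, s != [::] -> {in s, forall x, K x} -> K (barycenter s).

Lemma sum_const_seq (M : nmodType) (T : Type) (s : seq T) (x : M) :
  \sum_(y <- s) x = x *+ size s.
Proof. by rewrite big_const_seq count_predT iter_addr_0. Qed.

Lemma barycenter_sub s c : s != [::] ->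
  barycenter s - c = (size s)%:R^-1 *: \sum_(x <- s) (x - c).
Proof.
move=> s0; rewrite /barycenter sumrB scalerBr; congr (_ - _).
rewrite sum_const_seq -[c *+ _]scaler_nat scalerA mulVf ?scale1r//.
by rewrite pnatr_eq0 size_eq0.
Qed.

Lemma bary_closed_ball c r : bary_closed [set x | `|x - c| <= r].
Proof.
move=> s s0 sr /=; have sp : 0 < (size s)%:R :> R by rewrite ltr0n lt0n size_eq0.
rewrite barycenter_sub// normrZ ger0_norm ?invr_ge0 ?ler0n//.
rewrite mulrC ler_pdivrMr//; apply: le_trans (ler_norm_sum _ _ _) _.
by rewrite mulr_natr -sum_const_seq !big_seq; apply: ler_sum => x /sr.
Qed.

Lemma bary_closedI K K' : bary_closed K -> bary_closed K' ->
  bary_closed (K `&` K').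
Proof.
by move=> cK cK' s s0 sK; split; [apply: cK|apply: cK'] => // x /sK[].
Qed.

(** Among the differences to [x] that are averaged, the one of [x] with itself vanishes, so at most
    [size s - 1] of the [size s] terms contribute, each at most [r]. *)
Lemma barycenter_dist s r x : x \in s ->
  {in s &, forall x y, `|x - y| <= r} ->
  `|barycenter s - x| <= (1 - (size s)%:R^-1) * r.
Proof.
move=> xs sr; have s0 : s != [::] by case: s xs {sr}.
have sp : 0 < (size s)%:R :> R by rewrite ltr0n lt0n size_eq0.
rewrite barycenter_sub// normrZ ger0_norm ?invr_ge0 ?ler0n//.
rewrite mulrC ler_pdivrMr// mulrAC mulrBl mul1r mulVf ?lt0r_neq0//.
apply: le_trans (ler_norm_sum _ _ _) _.
rewrite (perm_big _ (perm_to_rem xs)) big_cons /= subrr normr0 add0r.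
have -> : ((size s)%:R - 1) * r = \sum_(y <- rem x s) r.
  rewrite sum_const_seq size_rem// -[r *+ _]mulr_natl; congr (_ * _).
  by rewrite -[in LHS](prednK (n := size s)) ?lt0n ?size_eq0// mulrSr addrK.
rewrite !big_seq; apply: ler_sum => y ys.
by rewrite sr// (mem_rem ys).
Qed.

Definition small_simplex n K r s := [/\ size s = n,
  {in s, forall x, K x} & {in s &, forall x y, `|x - y| <= r}].

(** The induction descends to faces with fewer vertices; the fixed bound [M] gives all of them the
    same contraction factor. *)
Lemma small_simplex_subdivide M n K r s : (n <= M)%N -> bary_closed K ->
  small_simplex n K r s ->
  spanned (small_simplex n K ((1 - M%:R^-1) * r)) (subdivide n << s >>).
Proof.
elim: n K s => [|n IH] K s nM cK [sn sK sr].
  apply: spannedU; split=> //; case: s sn {sK sr} => // _ x y; by rewrite in_nil.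
have s0 : s != [::] by rewrite -size_eq0 sn.
have bs x : x \in s -> `|barycenter s - x| <= (1 - M%:R^-1) * r.
  move=> xs; apply: le_trans (barycenter_dist xs sr) _; rewrite sn.
  have r0 : 0 <= r by apply: le_trans (sr _ _ xs xs).
  rewrite ler_wpM2r// lerB// lef_pV2 ?posrE ?ltr0n ?ler_nat//.
  exact: leq_trans nM.
(* Intersecting with a ball about the barycenter makes the induction hypothesis also bound the
   distance from the new apex to every vertex of the subdivided faces. *)
set K' := K `&` [set x | `|x - barycenter s| <= (1 - M%:R^-1) * r].
have cK' : bary_closed K' by apply: bary_closedI cK _; apply: bary_closed_ball.
rewrite subdivideU.
have : spanned (small_simplex n K' ((1 - M%:R^-1) * r))
    (subdivide n (list_faces s)).
  apply: spanned_linear (list_faces_spanned s) => t [st ts].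
  apply: IH => //; first exact: ltnW.
  split=> [|x /ts xs|x y /ts xs /ts ys]; last exact: sr.
    by case: (st); rewrite sn => -[].
  by split; [exact: sK|rewrite /= distrC bs].
apply: spanned_linear => t [st tK tr]; rewrite /= join_vertexU.
apply: spannedU; split=> [|x|x y] /=; first by rewrite st.
  by rewrite inE => /predU1P[->|/tK[]//]; apply: cK.
have q0 : 0 <= (1 - M%:R^-1) * r.
  by case: (s) s0 bs => // z s' _ /(_ z); rewrite mem_head => /(_ isT);
    apply: le_trans.
rewrite !inE => /predU1P[->|xt] /predU1P[->|yt].
- by rewrite subrr normr0.
- by rewrite distrC; case: (tK _ yt).
- by case: (tK _ xt).
- exact: tr.
Qed.

Lemma small_simplex_iter_subdivide N n K r s : bary_closed K ->
  small_simplex n K r s ->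
  spanned (small_simplex n K ((1 - n%:R^-1) ^+ N * r))
    (iter N (subdivide n) << s >>).
Proof.
move=> cK ss; elim: N => [|N IH] /=.
  by rewrite expr0 mul1r; apply: spannedU.
apply: spanned_linear IH => t tt; rewrite exprS -mulrA.
exact: small_simplex_subdivide.
Qed.

Lemma simplex_in_subdivide_htpy n K s : bary_closed K ->
  simplex_in n K s -> spanned (simplex_in n.+1 K) (subdivide_htpy n << s >>).
Proof.
elim: n s => [|n IH] s cK [sn sK]; first exact: spanned0.
have s0 : s != [::] by rewrite -size_eq0 sn.
rewrite subdivide_htpyU.
have : spanned (simplex_in n.+1 K) (<< s >> - subdivide_htpy n (list_faces s)).
  apply: spannedB; first exact: spannedU.
  apply: spanned_linear (list_faces_spanned s) => t [st ts].
  apply: IH => //; split=> [|x /ts/sK//].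
  by case: (st); rewrite sn => -[].
apply: spanned_linear => t [st tK]; rewrite /= join_vertexU.
apply: spannedU; split=> [|x] /=; first by rewrite st.
by rewrite inE => /predU1P[->|/tK//]; apply: cK.
Qed.

Lemma simplex_in_subdivide n K s : bary_closed K ->
  simplex_in n K s -> spanned (simplex_in n K) (subdivide n << s >>).
Proof.
elim: n s => [|n IH] s cK [sn sK]; first exact: spannedU.
have s0 : s != [::] by rewrite -size_eq0 sn.
rewrite subdivideU.
have : spanned (simplex_in n K) (subdivide n (list_faces s)).
  apply: spanned_linear (list_faces_spanned s) => t [st ts].
  apply: IH => //; split=> [|x /ts/sK//].
  by case: (st); rewrite sn => -[].
apply: spanned_linear => t [st tK]; rewrite /= join_vertexU.
apply: spannedU; split=> [|x] /=; first by rewrite st.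
by rewrite inE => /predU1P[->|/tK//]; apply: cK.
Qed.

End Mesh.

(** * Lebesgue numbers of covers of compact subspaces *)

Lemma subtype_nbhs {V : topologicalType} (K : set V) (x : K) (A : set K) :
  nbhs x A -> nbhs (\val x) (fun v => forall Kv : K v, A (SigSub (mem_set Kv))).
Proof.
move=> [B [[C oC CB] Bx BA]].
have Cx : C (\val x) by rewrite -CB in Bx.
apply: filterS (open_nbhs_nbhs (conj oC Cx)) => v Cv Kv.
by apply: BA; rewrite -CB.
Qed.

Lemma lebesgue_number {R : realType} {V : normedModType R} (I : Type)
    (K : set V) (U : I -> set K) : compact K ->
  (forall x : K, exists i, nbhs x (U i)) ->
  exists2 r : R, 0 < r & forall x : K,
    exists i, forall y : K, `|\val y - \val x| <= r -> U i y.
Proof.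
move=> /compact_near_coveringP cK KU.
pose Q (r : R) (x : V) := forall Kx : K x,
  exists i, forall y : K, `|\val y - x| <= r -> U i y.
have : \forall r \near 0^'+, K `<=` Q r.
  apply: cK => x Kx; have [i /subtype_nbhs /nbhs_ballP[e /= e0 xe]] :=
    KU (SigSub (mem_set Kx)).
  (* Half of [e] is for the distance from [x] to [y], the other half for the radius [r] about [y];
     together they stay in the ball of radius [e], which lies in [U i]. *)
  exists (ball x (e / 2), [set r | r < e / 2]) => /=.
    split; first by apply: nbhsx_ballx; rewrite divr_gt0.
    by apply: nbhs_right_lt; rewrite divr_gt0.
  move=> [y r] /= [xy re] Ky; exists i => z zy.
  have Kz : K (\val z) by exact/set_mem/valP.
  have -> : z = SigSub (mem_set Kz) by apply/val_inj.
  apply: xe; rewrite -ball_normE /= in xy *; rewrite (splitr e).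
  rewrite -(subrK y x) -addrA; apply: le_lt_trans (ler_normD _ _) _.
  by rewrite ltrD// distrC; apply: le_lt_trans zy re.
move=> H; have [r [r0 Hr]] : exists r : R, 0 < r /\ K `<=` Q r.
  near (0 : R)^'+ => r; exists r; split; first by near: r; exact: nbhs_right_gt.
  by near: r.
by exists r => // x; apply: Hr; exact/set_mem/valP.
Unshelve. all: by end_near.
Qed.

(** * The sign cochain of a labelling *)

Section LabelCochain.
Context {R : realType}.

(* The sign of [l] if it enumerates the nonzero labels, and 0 otherwise. *)
Definition label_det k (l : seq 'I_k.+1) : R :=
  \det (\matrix_(a < k, b < k) (nth ord0 l a == fintype.lift ord0 b)%:R).

(** The cocycle property of the sign cochain on simplices that miss a label: the alternating sum is
    the determinant of a product, one of whose factors has a zero column at the missing label. *)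
Lemma label_det_coboundary k (l : seq 'I_k.+1) (b : 'I_k.+1) :
  size l = k.+1 -> b \notin l ->
  \sum_(i < k.+1) (-1) ^+ i * label_det (take i l ++ drop i.+1 l) = 0.
Proof.
move=> lk bl.
pose B : 'M[R]_k.+1 := \matrix_(a, c) (nth ord0 l a == c)%:R.
(* The sum is the determinant of [B] with column 0 replaced by the constant
   column 1, which is the sum of all columns of [B]. *)
pose U : 'M[R]_k.+1 :=
  \matrix_(c, e) (if unlift ord0 e is Some _ then (c == e)%:R else 1).
have detB : \det B = 0.
  rewrite (expand_det_col B b); apply: big1 => a _.
  rewrite mxE; case: eqP => [e|_]; last by rewrite mul0r.
  by case/negP: bl; rewrite -e mem_nth// lk.
have dBU : \det (B *m U) = 0 by rewrite det_mulmx detB mul0r.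
rewrite -[RHS]dBU (expand_det_col _ ord0); apply: eq_bigr => i _.
have BU a e : (B *m U) a e = if unlift ord0 e is Some _ then
    (nth ord0 l a == e)%:R else 1.
  rewrite mxE (bigD1 (nth ord0 l a)) //= big1 ?addr0 => [|c /negPf ne].
    rewrite !mxE eqxx mul1r; by case: unlift.
  by rewrite mxE eq_sym ne mul0r.
rewrite BU unlift_none mul1r /cofactor addn0; congr (_ * \det _).
apply/matrixP => a e. rewrite mxE [in RHS]mxE [in RHS]mxE BU fintype.liftK; congr (_ == _)%:R.
rewrite nth_cat size_take lk ltn_ord /= /bump; case: (ltnP a i) => ai.
  by rewrite nth_take// add0n.
by rewrite nth_drop; congr (nth _ _ _); lia.
Qed.

Lemma list_facesE (V : lmodType R) (s : seq V) : list_faces s =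
  \sum_(i < size s) (-1) ^+ i *: << take i s ++ drop i.+1 s >>.
Proof.
elim: s => [|v s IH] /=; first by rewrite big_ord0.
rewrite big_ord_recl /= drop0 expr0 scale1r IH linear_sum -sumrN.
congr (_ + _); apply: eq_bigr => i _.
by rewrite linearZ /= join_vertexU exprS mulN1r scaleNr.
Qed.

Context {V : lmodType R} k (f : V -> 'I_k.+1).

Definition label_eval : {freeg (seq V) / R} -> R^o :=
  fglift (fun s => label_det (map f s) : R^o).
HB.instance Definition _ := GRing.Linear.on label_eval.

Lemma label_evalU s : label_eval << s >> = label_det (map f s).
Proof. by rewrite /label_eval liftU scale1r. Qed.

Lemma label_eval_bd s b : simplex_in k.+1 [set x | f x != b] s ->
  label_eval (bd << s >>) = 0.
Proof.
move=> [sk sb]; rewrite bdU list_facesE linear_sum /= sk.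
rewrite -[RHS](@label_det_coboundary k (map f s) b) ?size_map//.
  apply: eq_bigr => i _; rewrite linearZ /= label_evalU map_cat.
  by rewrite map_take map_drop.
by apply/negP => /mapP[x /sb /= /eqP + bx]; rewrite -bx.
Qed.

End LabelCochain.

(** * The finite model of the sphere and maps into it *)

(* With the down-closed families as open sets this is the face poset of the
   boundary of a simplex with [n] vertices, a finite model of the sphere of
   dimension [n - 2]. *)
Definition proper_subset n :=
  {A : {ffun 'I_n -> bool} | [exists b, A b] && [exists b, ~~ A b]}.

Definition proper_subset_fun n (A : proper_subset n) : 'I_n -> bool := val A.
Coercion proper_subset_fun : proper_subset >-> Funclass.

HB.instance Definition _ n := Finite.on (proper_subset n).

Section ProperSubset.
Context {n : nat}.

Implicit Types A B : proper_subset n.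


Lemma proper_subset_eq A B : (forall b, A b = B b) -> A = B.
Proof. by move=> AB; apply/val_inj/ffunP. Qed.

Lemma proper_subset_ex A : exists b, A b.
Proof. by have /andP[/existsP] := valP A. Qed.

Lemma proper_subset_nex A : exists b, ~~ A b.
Proof. by have /andP[_ /existsP] := valP A. Qed.

Definition down_closed (U : set (proper_subset n)) :=
  forall A B, (forall b, A b -> B b) -> U B -> U A.

Lemma down_closedT : down_closed setT. Proof. by []. Qed.

Lemma down_closedI : setI_closed down_closed.
Proof. by move=> U W dU dW A B AB [UB WB]; split; [apply: dU UB|apply: dW WB]. Qed.

Lemma down_closed_bigU (I : Type) (F : I -> set (proper_subset n)) :
  (forall i, down_closed (F i)) -> down_closed (\bigcup_i F i).
Proof. by move=> dF A B AB [i _ FB]; exists i => //; apply: dF FB. Qed.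

HB.instance Definition _ := isOpenTopological.Build (proper_subset n)
  down_closedT down_closedI down_closed_bigU.

Lemma open_missing b : open [set A : proper_subset n | ~~ A b].
Proof. by move=> A B AB /=; apply: contra; apply: AB. Qed.

Lemma closed_containing (T : topologicalType) (f : T -> proper_subset n) b :
  continuous f -> closed [set t | f t b].
Proof.
move=> /continuousP/(_ _ (@open_missing b)) /open_closedC.
congr closed; apply/seteqP; split => t /=; first by move/negP; rewrite negbK.
by move=> ft; apply/negP; rewrite negbK.
Qed.

(** Near [t] the closed sets that avoid [t] are still avoided, so [f t'] is contained in [f t], and
    open sets are down-closed. A map to this space is thus the same as a finite family of closed
    sets, properly chosen at each point. *)
Lemma proper_subset_continuous (T : topologicalType) (f : T -> proper_subset n) :
  (forall b, closed [set t | f t b]) -> continuous f.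
Proof.
move=> cf; apply/continuousP => U dU.
rewrite openE => t Ut; rewrite /interior /=.
have : \forall t' \near t, forall b, ~~ f t b -> ~~ f t' b.
  apply: filter_forall => b; case: (boolP (f t b)) => [_|ftb].
    by apply: nearW.
  have : nbhs t (~` [set t | f t b]).
    by apply: open_nbhs_nbhs; split; [exact: closed_openC|apply/negP].
  by apply: filterS => t' /negP ft' _.
apply: filterS => t' tt'; apply: dU Ut => b; apply: contraLR; exact: tt'.
Qed.

Lemma proper_subset_map (T : topologicalType) (F : T -> 'I_n -> bool) :
  (forall t, exists b, F t b) -> (forall t, exists b, ~~ F t b) ->
  (forall b, closed [set t | F t b]) ->
  exists f : T -> proper_subset n, continuous f /\ forall t b, f t b = F t b.
Proof.
move=> F1 F0 cF.
have P t : [exists b, [ffun b => F t b] b] && [exists b, ~~ [ffun b => F t b] b].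
  have [b Fb] := F1 t; have [c Fc] := F0 t.
  by apply/andP; split; apply/existsP; [exists b|exists c]; rewrite ffunE.
exists (fun t => exist _ [ffun b => F t b] (P t)); split=> [|t b].
  apply: proper_subset_continuous => b; move: (cF b).
  by congr closed; apply/seteqP; split => t; rewrite /= /proper_subset_fun /= ffunE.
by rewrite /proper_subset_fun /= ffunE.
Qed.

(** The points whose image misses a given label form an open set, and these sets cover [K] because
    the images are proper subsets. *)
Lemma small_sets_miss_label {R : realType} {V : normedModType R} (K : set V)
    (f : K -> proper_subset n) : compact K -> continuous f ->
  exists2 r : R, 0 < r & forall x : K,
    exists b, forall y : K, `|\val y - \val x| <= r -> ~~ f y b.
Proof.
move=> cK cf; apply: (lebesgue_number (U := fun b => [set y | ~~ f y b])) => // x.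
have [b fxb] := proper_subset_nex (f x); exists b.
have /continuousP/(_ _ (@open_missing b)) := cf => oU.
exact: open_nbhs_nbhs.
Qed.

End ProperSubset.

(** * Closedness of sets given by boolean conditions *)

Section BooleanClosed.
Context {T : topologicalType}.

Lemma closed_orb (P Q : pred T) : closed [set t | P t] -> closed [set t | Q t] ->
  closed [set t | P t || Q t].
Proof.
move=> cP cQ; have := closedU cP cQ; congr closed.
by apply/seteqP; split => t /= /orP.
Qed.

Lemma closed_andb (P Q : pred T) : closed [set t | P t] -> closed [set t | Q t] ->
  closed [set t | P t && Q t].
Proof.
move=> cP cQ; have := closedI cP cQ; congr closed.
by apply/seteqP; split => t /= /andP.
Qed.

Lemma closed_cst (b : bool) : closed [set t : T | b].
Proof.
case: b; first by rewrite (_ : [set _ | _] = setT); [exact: closedT|apply/seteqP; split].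
by rewrite (_ : [set _ | _] = set0); [exact: closed0|apply/seteqP; split].
Qed.

Lemma closed_existsb (I : finType) (P : I -> pred T) :
  (forall i, closed [set t | P i t]) -> closed [set t | [exists i, P i t]].
Proof.
move=> cP; have /(_ (index_enum I)) := @closed_bigsetU T I _ (fun i => [set t | P i t]).
move=> /(_ (fun i _ => cP i)); congr closed.
rewrite -bigcup_seq; apply/seteqP; split => t /=.
  by case=> i _ Pt; apply/existsP; exists i.
by case/existsP => i Pt; exists i => //=; exact: mem_index_enum.
Qed.

Context {R : realType} (f : T -> R) (cf : continuous f).

Lemma closed_le_fun c : closed [set t | f t <= c].
Proof. by apply: (preimage_closed _ (@closed_le _ c)) => t _; apply: cf. Qed.

Lemma closed_ge_fun c : closed [set t | c <= f t].
Proof. by apply: (preimage_closed _ (@closed_ge _ c)) => t _; apply: cf. Qed.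

End BooleanClosed.

(** * Simple connectivity of the finite sphere *)

Section SimplyConnected.
Context {R : realType} {n : nat}.
Local Notation I := (unit_interval R).
Implicit Types (x y : proper_subset n) (s t : I).

Lemma unit_interval_ge0 s : 0 <= \val s.
Proof. by have /set_mem /andP[] := valP s. Qed.

Lemma unit_interval_le1 s : \val s <= 1.
Proof. by have /set_mem /andP[] := valP s. Qed.

Lemma unit_interval_val_continuous : continuous (\val : I -> R).
Proof. exact: initial_continuous. Qed.

Lemma val_zero : \val (zero : I) = 0.
Proof. by []. Qed.

Lemma val_one : \val (one : I) = 1.
Proof. by []. Qed.

Lemma missing_label (s : seq 'I_n) : (size s < n)%N -> exists b, b \notin s.
Proof.
move=> sn; apply/existsP; rewrite -negb_forall; apply/negP => /forallP all_s.
have /subset_leq_card : 'I_n \subset s by apply/fintype.subsetP.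
by rewrite card_ord => /leq_trans/(_ (card_size _)); rewrite leqNgt sn.
Qed.

Let half_gt0 : (1 / 2 <= 0 :> R) = false.
Proof. by apply/negbTE; rewrite -ltNge divr_gt0. Qed.

Let half_lt1 : (1 <= 1 / 2 :> R) = false.
Proof. by apply/negbTE; rewrite -ltNge; lra. Qed.

Let one_gt0 : (1 <= 0 :> R) = false.
Proof. by apply/negbTE; rewrite -ltNge. Qed.

Let quarter_gt0 : (1 / 4 <= 0 :> R) = false.
Proof. by apply/negbTE; rewrite -ltNge divr_gt0. Qed.

Let quarter_lt_half : 1 / 4 < 1 / 2 :> R.
Proof. by lra. Qed.

Let le_of_lt_natr (i j : nat) : i%:R < j%:R + 1 :> R -> (i <= j)%N.
Proof. by rewrite natr1 ltr_nat ltnS. Qed.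

(** The path leaves [x] for one of its labels [a], passes at time 1/2 through the pair of [a] and
    [c], and goes from the label [c] to [y], which contains it. A third label keeps the pair
    proper. *)
Lemma proper_subset_path x y : (2 < n)%N -> inhabited {path I from x to y}.
Proof.
move=> n2; have [a xa] := proper_subset_ex x; have [c yc] := proper_subset_ex y.
pose F t b := [|| x b && (\val t <= 0), (b == a) && (\val t <= 1 / 2),
  (b == c) && (1 / 2 <= \val t) | y b && (1 <= \val t)].
have cv := unit_interval_val_continuous.
have F1 t : exists b, F t b.
  case: (lerP (\val t) (1 / 2)) => t2; [exists a|exists c]; rewrite /F eqxx /=.
    by rewrite t2 orbT.
  by rewrite (ltW t2) !orbT.
have Fzero b : F zero b = x b.
  rewrite /F val_zero lexx andbT.
  rewrite half_gt0 one_gt0.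
  rewrite !andbF !orbF; case: eqP => [->|_]; last by rewrite orbF.
  by rewrite xa.
have Fone b : F one b = y b.
  rewrite /F val_one lexx andbT.
  rewrite half_lt1 one_gt0.
  rewrite !andbF /=; case: eqP => [->|_] //=.
  by rewrite yc orbT.
have F0 t : exists b, ~~ F t b.
  have [t0|t0] := lerP (\val t) 0.
    have -> : t = zero.
      by apply/val_inj; rewrite val_zero; apply/eqP; rewrite eq_le t0 unit_interval_ge0.
    by have [b xb] := proper_subset_nex x; exists b; rewrite Fzero.
  have [t1|t1] := lerP 1 (\val t).
    have -> : t = one.
      by apply/val_inj; rewrite val_one; apply/eqP; rewrite eq_le t1 unit_interval_le1.
    by have [b yb] := proper_subset_nex y; exists b; rewrite Fone.
  have [b] := @missing_label [:: a; c] n2.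
  rewrite !inE negb_or => /andP[/negPf ba /negPf bc]; exists b.
  by rewrite /F ba bc !leNgt t0 t1 !andbF.
have cF b : closed [set t | F t b].
  do 3?apply: closed_orb; apply: closed_andb; try exact: closed_cst;
    by [apply: closed_le_fun | apply: closed_ge_fun].
have [f [cf fE]] := proper_subset_map F1 F0 cF.
have f0 : f zero = x by apply: proper_subset_eq => b; rewrite fE.
have f1 : f one = y by apply: proper_subset_eq => b; rewrite fE.
exact: (inhabits (mk_path cf f0 f1 : {path I from x to y})).
Qed.

Lemma unit_interval_compact : compact [set t : R | 0 <= t <= 1].
Proof.
rewrite (_ : [set t : R | _] = `[0, 1]%classic); first exact: segment_compact.
by apply/seteqP; split => t /=; rewrite in_itv.
Qed.

Lemma proper_subset_loop x (p : {path I from x to x}) : (3 < n)%N ->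
  path_homotopic p (cst x).
Proof.
move=> n3; pose q s : proper_subset n := p s.
have q0 : q zero = x := path_zero.
have q1 : q one = x := path_one.
have [r r0 missr] := small_sets_miss_label (V := R^o) (f := p)
  unit_interval_compact (@cts_fun _ _ p).
(* The grid step [1/N] is below the Lebesgue number [r], so the values of the loop at [s] and at the
   grid points near [s] miss a common label. *)
pose N := (Num.truncn r^-1).+1; pose NR : R := N%:R.
have N0 : 0 < NR by rewrite ltr0n.
have NrV : NR^-1 < r.
  rewrite invf_plt ?posrE//; have /truncn_itv/andP[_ //] : 0 <= r^-1.
  by rewrite invr_ge0 ltW.
have pt_proof (j : 'I_N.+1) : [set t : R | 0 <= t <= 1] (j%:R / NR).
  rewrite /= divr_ge0 ?ler0n//= ler_pdivrMr// mul1r ler_nat.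
  by rewrite -ltnS.
pose pt j : I := SigSub (mem_set (pt_proof j)).
have ptE j : \val (pt j) = j%:R / NR by [].
have /fin_all_exists[a pa] : forall j, exists b, q (pt j) b.
  by move=> j; exact: proper_subset_ex.
have [a0 xa0] := proper_subset_ex x.
pose near_grid s (j : 'I_N.+1) :=
  (j%:R - 1 / 2 <= NR * \val s) && (NR * \val s <= j%:R + 1 / 2).
pose g s b := [exists j, (b == a j) && near_grid s j].
pose edge (z : I * I) := [|| \val z.1 <= 0, 1 <= \val z.1 | 1 <= \val z.2].
(* A closed relation between points and labels is a continuous family of
   subsets: as time passes, the loop is first thinned out to single labels
   chosen at grid points, then replaced by the label [a0]; adding [x] on three
   sides of the square keeps the end points fixed. *)
pose F (z : I * I) b := [|| q z.1 b && (\val z.2 <= 1 / 4),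
  g z.1 b && ((1 / 4 <= \val z.2) && (\val z.2 <= 1 / 2)),
  (b == a0) && (1 / 2 <= \val z.2) | x b && edge z].
(* On these three sides nothing but [x] is present: at the ends of the loop the only near grid point
   is the end itself, whose label was chosen in [x], and [a0] is in [x] too. *)
have Fedge z b : edge z -> F z b = x b.
  case: z => s t ez; rewrite /F ez andbT /=.
  case xb : (x b); first by rewrite !orbT.
  have b0 : (b == a0) = false by apply/eqP => ba; rewrite ba xa0 in xb.
  rewrite b0 /= !orbF; case/or3P: ez => /= est.
  - have s0 : s = zero.
      by apply/val_inj; rewrite val_zero; apply/eqP; rewrite eq_le est unit_interval_ge0.
    rewrite s0 q0 xb /=; apply/negP => /andP[/existsP[j /andP[/eqP bj]]].
    rewrite /near_grid val_zero mulr0 => /andP[j0 _] _.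
    have j0' : j = 0%N :> nat.
      apply/eqP; rewrite -leqn0; apply: le_of_lt_natr.
      by move: (j%:R : R) j0 => u; lra.
    have pj : pt j = zero by apply/val_inj; rewrite ptE j0' mul0r.
    by have := pa j; rewrite pj q0 -bj xb.
  - have s1 : s = one.
      by apply/val_inj; rewrite val_one; apply/eqP; rewrite eq_le est unit_interval_le1.
    rewrite s1 q1 xb /=; apply/negP => /andP[/existsP[j /andP[/eqP bj]]].
    rewrite /near_grid val_one mulr1 => /andP[_ jN] _.
    have jN' : j = N :> nat.
      apply/eqP; rewrite eqn_leq -ltnS ltn_ord /=; apply: le_of_lt_natr.
      by rewrite -/NR; move: (j%:R : R) (NR) jN => u v; lra.
    have pj : pt j = one by apply/val_inj; rewrite ptE jN' divff// lt0r_neq0.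
    by have := pa j; rewrite pj q1 -bj xb.
  - rewrite [_ <= 1 / 4]leNgt [_ <= 1 / 2]leNgt.
    by rewrite !(lt_le_trans _ est) ?andbF ?ltr_pdivrMr ?mul1r ?ltr1n.
have F1 z : exists b, F z b.
  case: z => s t; rewrite /F /=; have [t4|t4] := lerP (\val t) (1 / 4).
    by have [b pb] := proper_subset_ex (q s); exists b; rewrite pb.
  have [t2|t2] := lerP (\val t) (1 / 2); last first.
    by exists a0; rewrite eqxx (ltW t2) !orbT.
  have s0 := unit_interval_ge0 s; have s1 := unit_interval_le1 s.
  have Ns0 : 0 <= NR * \val s by rewrite mulr_ge0// ltW.
  have Ns1 : NR * \val s <= NR by rewrite ler_piMr// ltW.
  (* Rounding to the nearest grid point: the closed half-step intervals around grid points cover the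
     whole interval. *)
  pose j := Num.truncn (NR * \val s + 1 / 2).
  have /truncn_itv/andP[j1 j2] : 0 <= NR * \val s + 1 / 2 by lra.
  rewrite -/j in j1; rewrite -/j -[j.+1%:R]natr1 in j2.
  have jN : (j < N.+1)%N.
    rewrite ltnS; apply: le_of_lt_natr; rewrite -/NR.
    by move: (j%:R : R) (NR) (NR * _) j1 j2 Ns1 => u v w; lra.
  exists (a (Ordinal jN)); rewrite (ltW t4) /=; apply/orP; right; apply/orP; left.
  rewrite andbT; apply/existsP; exists (Ordinal jN); rewrite eqxx /near_grid /=.
  by move: (j%:R : R) (NR * _) j1 j2 => u v j1 j2; apply/andP; split; lra.
have F0 z : exists b, ~~ F z b.
  case ez : (edge z).
    by have [b xb] := proper_subset_nex x; exists b; rewrite Fedge.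
  case: z ez => s t ez; rewrite /F ez /=.
  have [t4|t4] := lerP (\val t) (1 / 4).
    have [b pb] := missr s; exists b.
    rewrite (negPf (pb s _)) ?subrr ?normr0 ?(ltW r0)//= andbF orbF.
    have -> : (1 / 2 <= \val t) = false.
      by apply/negbTE; rewrite -ltNge; apply: le_lt_trans t4 quarter_lt_half.
    rewrite andbF orbF.
    apply/negP => /andP[/existsP[j /andP[/eqP bj /andP[j1 j2]]] _].
    suff /(pb (pt j)) : `|\val (pt j) - \val s| <= r by apply/negP/negPn; rewrite bj pa.
    rewrite ptE; apply: le_trans _ (ltW NrV).
    have jE : NR * (j%:R / NR - \val s) = j%:R - NR * \val s.
      by rewrite mulrBr mulrCA divff ?mulr1// lt0r_neq0.
    have normM d : NR * `|d| = `|NR * d| by rewrite normrM gtr0_norm.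
    rewrite -[leRHS]mulr1 ler_pdivlMl// normM jE.
    move: (j%:R : R) (NR * _) j1 j2 => u v j1 j2.
    by rewrite ler_norml; apply/andP; split; lra.
  pose i := Num.truncn (NR * \val s).
  have s0 := unit_interval_ge0 s.
  have /truncn_itv/andP[i1 i2] : 0 <= NR * \val s by rewrite mulr_ge0// ltW.
  rewrite -/i in i1; rewrite -/i -[i.+1%:R]natr1 in i2.
  (* After time 1/4 only the labels of the two grid points around [s] and the label [a0] can occur;
     a fourth label makes their set proper. *)
  have [b] := @missing_label [:: a (inord i); a (inord i.+1); a0] n3.
  rewrite !inE !negb_or => /and3P[bi bi1 b0]; exists b.
  rewrite andbF /= (negPf b0) /= andbF !orbF.
  apply/negP => /andP[/existsP[j /andP[/eqP bj /andP[j1 j2]]] _].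
  have ij : (i <= j)%N.
    apply: le_of_lt_natr.
    by move: (j%:R : R) (i%:R : R) (NR * _) j1 j2 i1 i2 => u v w; lra.
  have ji : (j <= i.+1)%N.
    apply: le_of_lt_natr; rewrite -[i.+1%:R]natr1.
    by move: (j%:R : R) (i%:R : R) (NR * _) j1 j2 i1 i2 => u v w; lra.
  have [ji'|ji'] := eqVneq (nat_of_ord j) i.
    by move/eqP: bi; rewrite bj; case; congr a; apply/val_inj; rewrite /= -ji' inordK.
  have ji2 : nat_of_ord j = i.+1.
    by apply/eqP; rewrite eqn_leq ji ltn_neqAle eq_sym ji' ij.
  by move/eqP: bi1; rewrite bj; case; congr a; apply/val_inj; rewrite /= -ji2 inordK.
have cv1 : continuous (fun z : I * I => \val z.1 : R).
  by move=> z; apply: continuous_comp; [exact: cvg_fst|exact: unit_interval_val_continuous].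
have cv2 : continuous (fun z : I * I => \val z.2 : R).
  by move=> z; apply: continuous_comp; [exact: cvg_snd|exact: unit_interval_val_continuous].
have cN : continuous (fun z : I * I => NR * \val z.1 : R).
  by move=> z; apply: cvgM; [exact: cvg_cst|exact: cv1].
have cF b : closed [set z | F z b].
  apply: closed_orb.
    apply: closed_andb; last exact: closed_le_fun.
    apply: (@closed_containing _ _ (fun z : I * I => q z.1)) => z.
    by apply: continuous_comp; [exact: cvg_fst|exact: cts_fun].
  apply: closed_orb.
    apply: closed_andb; last by apply: closed_andb;
      [exact: closed_ge_fun|exact: closed_le_fun].
    apply: closed_existsb => j; apply: closed_andb; first exact: closed_cst.
    by apply: closed_andb; [exact: closed_ge_fun|exact: closed_le_fun].
  apply: closed_orb.
    by apply: closed_andb; [exact: closed_cst|exact: closed_ge_fun].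
  apply: closed_andb; first exact: closed_cst.
  apply: closed_orb; first exact: closed_le_fun.
  by apply: closed_orb; exact: closed_ge_fun.
have [f [cf fE]] := proper_subset_map F1 F0 cF.
pose H : continuousType (I * I)%type (proper_subset n) :=
  HB.pack f (isContinuous.Build _ _ f cf).
exists H; split=> [s|s|t|t]; apply: proper_subset_eq => b; rewrite /H /= fE.
- case ez : (edge (s, zero)).
    rewrite Fedge //; case/or3P: ez => es.
    + suff -> : s = zero by rewrite path_zero.
      by apply/val_inj; rewrite val_zero; apply/eqP; rewrite eq_le es unit_interval_ge0.
    + suff -> : s = one by rewrite path_one.
      by apply/val_inj; rewrite val_one; apply/eqP; rewrite eq_le es unit_interval_le1.
    + by have := es; rewrite one_gt0.
  rewrite /F ez [(s, zero).2]/= val_zero half_gt0 quarter_gt0 ltW.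
    by rewrite !andbF andbT !orbF.
  by rewrite divr_gt0.
- by rewrite Fedge //; apply/or3P/Or33; apply: lexx.
- by rewrite Fedge //; apply/or3P/Or31; apply: lexx.
- by rewrite Fedge //; apply/or3P/Or32; apply: lexx.
Qed.

Lemma proper_subset_simply_connected :
  (3 < n)%N -> simply_connected R (proper_subset n).
Proof.
move=> n3; split; last by move=> x p; exact: proper_subset_loop.
split; last by move=> x y; apply: proper_subset_path; lia.
have n0 : (0 < n)%N by lia.
have n1 : (1 < n)%N by lia.
pose A : {ffun 'I_n -> bool} := [ffun b => b == Ordinal n0].
suff P : [exists b, A b] && [exists b, ~~ A b].
  exact: (inhabits (exist _ A P : proper_subset n)).
apply/andP; split; apply/existsP.
  by exists (Ordinal n0); rewrite ffunE.
by exists (Ordinal n1); rewrite ffunE.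
Qed.

End SimplyConnected.

(** * The standard simplex, its vertices and its faces *)

Section StdSimplex.
Context {R : realType} {n : nat}.
Local Notation simplex := (@std_simplex R n).

Lemma std_simplex_compact : compact simplex.
Proof.
have cI (i : 'I_n.+1) : compact (`[0, 1]%classic : set R) := @segment_compact R 0 1.
apply: subclosed_compact (rV_compact cI) _.
  have -> : simplex = \bigcap_i [set v : 'rV[R]_n.+1 | 0 <= v ord0 i] `&`
      [set v : 'rV[R]_n.+1 | \sum_i v ord0 i = 1].
    apply/seteqP; split => v /= -[v0 v1]; split=> // i; last exact: (v0 i).
    by move=> _; apply: v0.
  apply: closedI.
    apply: closed_bigI => i _; apply: (preimage_closed _ (@closed_ge _ (0 : R))).
    by move=> v _; apply: coord_continuous.
  apply: (preimage_closed (f := fun v : 'rV[R]_n.+1 => \sum_i v ord0 i) _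
    (@closed_eq _ (1 : R))) => v _.
  elim: (index_enum _) => [|i s IH].
    under [X in continuous_at _ X]eq_fun do rewrite big_nil.
    exact: cst_continuous.
  under [X in continuous_at _ X]eq_fun do rewrite big_cons.
  by apply: continuousD => //; apply: coord_continuous.
move=> v [v0 v1] i /=; rewrite in_itv /= v0 -v1 (bigD1 i) //= lerDl.
by apply: sumr_ge0.
Qed.

Lemma std_simplex_bary_closed : bary_closed simplex.
Proof.
move=> s s0 sS; have sp : 0 < (size s)%:R :> R by rewrite ltr0n lt0n size_eq0.
split=> [i|].
  rewrite mxE summxE mulr_ge0 ?invr_ge0 ?ler0n// big_seq sumr_ge0// => v /sS[].
  by [].
under eq_bigr do rewrite mxE summxE.
rewrite -mulr_sumr exchange_big /= big_seq.
under eq_bigr => v /sS[_ ->] do over.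
by rewrite -big_seq sum_const_seq mulVf// lt0r_neq0.
Qed.

Definition vertices : seq 'rV[R]_n.+1 := [seq delta_mx ord0 i | i <- enum 'I_n.+1].

Lemma size_vertices : size vertices = n.+1.
Proof. by rewrite size_map size_enum_ord. Qed.

Lemma nth_vertices i : (i < n.+1)%N -> vertices`_i = delta_mx ord0 (inord i).
Proof.
move=> ni; rewrite (nth_map ord0) ?size_enum_ord//; congr (delta_mx _ _).
by apply/val_inj; rewrite /= nth_enum_ord// inordK.
Qed.

Lemma vertices_simplex : {in vertices, forall v, std_simplex v}.
Proof.
move=> _ /mapP[i _ ->]; split=> [j|]; first by rewrite mxE ler0n.
rewrite (bigD1 i) //= mxE !eqxx big1 ?addr0// => j ji.
by rewrite mxE (negPf ji) andbF.
Qed.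

End StdSimplex.

Arguments vertices : clear implicits.

Section FaceRow.
Context {R : realType} {n : nat}.

Lemma face_row_linear (i : 'I_n.+2) : linear (@face_row R n i).
Proof.
move=> a v w; apply/rowP => j; rewrite !mxE.
by case: unlift => [k|]; rewrite ?mxE// mulr0 addr0.
Qed.

HB.instance Definition _ (i : 'I_n.+2) := GRing.isLinear.Build R
  'rV[R]_n.+1 'rV[R]_n.+2 *:%R (@face_row R n i) (face_row_linear i).

Lemma face_row_simplexE (i : 'I_n.+2) (v : 'rV[R]_n.+1) :
  std_simplex (face_row i v) <-> std_simplex v.
Proof.
split=> [[v0 v1]|Sv]; last by have := face_row_simplex i (SigSub (mem_set Sv)).
split=> [j|]; first by have := v0 (fintype.lift i j); rewrite mxE fintype.liftK.
rewrite -v1 [RHS](bigD1_ord i) //= [in RHS]mxE unlift_none add0r.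
by apply: eq_bigr => j _; rewrite mxE fintype.liftK.
Qed.

Lemma face_row_vertex (i : 'I_n.+2) (j : 'I_n.+1) :
  face_row i (delta_mx ord0 j : 'rV[R]_n.+1) = delta_mx ord0 (fintype.lift i j).
Proof.
apply/rowP => k; rewrite !mxE !eqxx /=; case: unliftP => [l ->|->].
  by rewrite mxE eqxx /= (inj_eq (@fintype.lift_inj _ i)).
by rewrite (negPf (fintype.neq_lift _ _)).
Qed.

Lemma map_face_row_vertices (i : 'I_n.+2) :
  map (face_row i) (vertices R n) =
  take i (vertices R n.+1) ++ drop i.+1 (vertices R n.+1).
Proof.
have i2 := ltn_ord i.
have sE : size (map (face_row i) (vertices R n)) =
    size (take i (vertices R n.+1) ++ drop i.+1 (vertices R n.+1)).
  by rewrite size_map size_cat size_take size_drop !size_vertices i2; lia.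
apply: (@eq_from_nth _ 0) => // j; rewrite size_map size_vertices => jn.
rewrite (nth_map 0) ?size_vertices// nth_vertices// face_row_vertex.
rewrite nth_cat size_take size_vertices i2; case: (ltnP j i) => ji.
  have jn2 := ltnW jn; rewrite nth_take// (nth_vertices jn2); congr (delta_mx _ _).
  by apply/val_inj; rewrite [RHS]/= /= (inordK jn) (inordK jn2) /bump leqNgt ji.
rewrite nth_drop (_ : (i.+1 + (j - i) = j.+1)%N); last lia.
have jn2 : (j.+1 < n.+2)%N by [].
rewrite (nth_vertices jn2); congr (delta_mx _ _).
by apply/val_inj; rewrite /= (inordK jn) (inordK jn2) /bump ji.
Qed.

(** The bridge between the two boundaries: faces of the universal simplex are linear images of the
    simplex one dimension lower, and these linear maps commute with subdivision. *)
Lemma bd_vertices : bd << vertices R n.+1 >> =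
  \sum_(i < n.+2) (-1) ^+ i *: map_list (face_row i) << vertices R n >>.
Proof.
rewrite bdU list_facesE size_vertices; apply: eq_bigr => i _.
by rewrite map_listU map_face_row_vertices.
Qed.

End FaceRow.

Section FreegInd.
Context {R : nzRingType} {K : choiceType}.

Lemma freeg_ind (P : {freeg K / R} -> Prop) : P 0 ->
  (forall a s c, P c -> P (a *: << s >> + c)) -> forall c, P c.
Proof.
move=> P0 PD c; rewrite -(freeg_sumE c); elim: (dom c) => [|s l IH].
  by rewrite big_nil.
rewrite big_cons (_ : << _ *g _ >> = coeff s c *: << s >>); first exact: PD.
by apply/eqP/freeg_eqP => x; rewrite coeffZ !coeffU mul1r.
Qed.

End FreegInd.

(** * Evaluating list chains on singular chains *)

Section SimplexLabel.
Context {R : realType} {m : nat}.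
Local Notation X := (proper_subset m.+1).

Definition pick_label (A : X) : 'I_m.+1 := xchoose (proper_subset_ex A).

Lemma pick_labelP (A : X) : A (pick_label A).
Proof. exact: xchooseP. Qed.

(** List chains have vertices in the whole vector space, hence the default label off the simplex;
    passing to faces respects this default. *)
Definition simplex_label n (s : @singular_simplex R X n) (v : 'rV[R]_n.+1) :
    'I_m.+1 :=
  if pselect (std_simplex v) is left Sv
  then pick_label (s (SigSub (mem_set Sv))) else ord0.

Lemma simplex_label_face n (s : @singular_simplex R X n.+1) (i : 'I_n.+2) v :
  simplex_label (s \o face i : singular_simplex X n) v =
  simplex_label s (face_row i v).
Proof.
rewrite /simplex_label; case: pselect => [Sv|nSv]; case: pselect => [Sw|nSw] //.
- by congr (pick_label (s _)); apply/val_inj.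
- by case: nSw; apply: (proj2 (face_row_simplexE i v)).
- by case: nSv; apply: (proj1 (face_row_simplexE i v)).
Qed.

Lemma label_eval_map (V W : lmodType R) (g : {linear V -> W})
    (f : W -> 'I_m.+1) c :
  label_eval f (map_list g c) = label_eval (f \o g) c.
Proof.
apply: (freeg_linear_ext (f := label_eval f \o map_list g)
  (g := label_eval (f \o g))) => s /=.
by rewrite map_listU !label_evalU map_comp.
Qed.

(** Subdivision is carried out once, on the list chain [w] in the model space; a singular simplex
    enters only through the labels that it induces there. *)
Definition chain_eval n (w : {freeg (seq 'rV[R]_n.+1) / R}) :
    @chain R X n -> R^o :=
  fglift (fun s => label_eval (simplex_label s) w).
HB.instance Definition _ n w := GRing.Linear.on (@chain_eval n w).

Lemma chain_evalU n w s : @chain_eval n w << s >> = label_eval (simplex_label s) w.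
Proof. by rewrite /chain_eval liftU scale1r. Qed.

(** Taking singular faces is adjoint to mapping list chains along the face inclusions, because a
    face of [s] labels [v] as [s] labels [face_row i v]. *)
Lemma chain_eval_boundary n w w' (c : @chain R X n.+1) :
  w = \sum_(i < n.+2) (-1) ^+ i *: map_list (face_row i) w' ->
  chain_eval w' (boundary c) = chain_eval w c.
Proof.
move=> ->; set w2 := \sum_i _.
apply: (freeg_linear_ext (f := chain_eval w' \o @boundary_succ R X n)
  (g := chain_eval w2)) c => s /=.
rewrite /boundary_succ liftU scale1r !linear_sum /= chain_evalU linear_sum.
apply: eq_bigr => i _; rewrite !linearZ /= chain_evalU label_eval_map.
by congr (_ *: label_eval _ _); apply/funext => v; rewrite simplex_label_face.
Qed.

(* The label is missed on all of [K] and not only on [s], for this passes to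
   subdivisions. *)
Definition uniform_miss (n : nat) (f : 'rV[R]_n.+1 -> 'I_m.+1) k s :=
  exists b (K : set 'rV[R]_n.+1), [/\ bary_closed K, simplex_in k K s &
    forall v, K v -> f v != b].

Lemma uniform_miss_htpy n (f : 'rV[R]_n.+1 -> 'I_m.+1) k s :
  uniform_miss f k s ->
  spanned (uniform_miss f k.+1) (subdivide_htpy k << s >>).
Proof.
move=> [b [K [cK sK Kb]]].
apply: spanned_sub (simplex_in_subdivide_htpy cK sK) => t tK.
by exists b, K.
Qed.

Lemma uniform_miss_subdivide n (f : 'rV[R]_n.+1 -> 'I_m.+1) k s :
  uniform_miss f k s -> spanned (uniform_miss f k) (subdivide k << s >>).
Proof.
move=> [b [K [cK sK Kb]]].
by apply: spanned_sub (simplex_in_subdivide cK sK) => t tK; exists b, K.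
Qed.

Lemma uniform_miss_eval n (f : 'rV[R]_n.+1 -> 'I_m.+1) c :
  spanned (uniform_miss f m.+1) c -> label_eval f (bd c) = 0.
Proof.
apply: (spanned_eq0 (f := label_eval f \o bd)) => s [b [K [_ [sm sK] Kb]]] /=.
by apply: (label_eval_bd (b := b)); split=> // v /sK /Kb.
Qed.

(** The mesh tends to 0, so it eventually falls below the Lebesgue number for the sets missing a
    label. *)
Lemma eventually_uniform_miss n (s : @singular_simplex R X n) k :
  (0 < k)%N -> (exists2 r, True & small_simplex k
    (@std_simplex R n) r (vertices R n)) ->
  \forall N \near \oo, spanned (uniform_miss (simplex_label s) k)
    (iter N (subdivide k) << vertices R n >>).
Proof.
move=> k0 [r _ vr].
have [e e0 es] := small_sets_miss_label (f := s) std_simplex_compact (@cts_fun _ _ s).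
have : \forall N \near \oo, (1 - k%:R^-1) ^+ N * r <= e.
  have q1 : `|1 - k%:R^-1 : R| < 1.
    have k1 : k%:R^-1 <= 1 :> R by rewrite invf_le1 ?ltr0n// ler1n.
    by rewrite ger0_norm ?subr_ge0// ltrBlDr ltrDl invr_gt0 ltr0n.
  have /cvgr_lt : ((1 - k%:R^-1) ^+ N * r) @[N --> \oo] --> (0 * r).
    by apply: cvgM; [exact: cvg_expr|exact: cvg_cst].
  by rewrite mul0r => /(_ _ e0); apply: filterS => N /ltW.
apply: filterS => N Ne.
have := small_simplex_iter_subdivide N std_simplex_bary_closed vr.
apply: spanned_sub => t [st tS tr].
have [v vt] : exists v, v \in t.
  by case: t st {tS tr} k0 => [<-//|v t _ _]; exists v; rewrite mem_head.
have [b eb] := es (SigSub (mem_set (tS v vt))).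
(* A simplex of small mesh lies in a ball about any of its vertices [v]; on that ball [b] is not in
   the image, so it cannot be picked as a label. *)
exists b, ((@std_simplex R n) `&` [set w | `|w - v| <= e]); split.
- exact: bary_closedI std_simplex_bary_closed (@bary_closed_ball _ _ _ _).
- split=> // w wt; split; first exact: (tS w wt).
  exact: le_trans (tr _ _ wt vt) Ne.
- move=> w [Sw we]; rewrite /simplex_label; case: pselect => // Sw'.
  have := eb (SigSub (mem_set Sw')) we; apply: contraNN => /eqP <-.
  exact: pick_labelP.
Qed.

End SimplexLabel.

(** * The degree form on homology *)

Lemma chain_ind (R : realType) (X : topologicalType) n (P : @chain R X n -> Prop) :
  P 0 -> (forall a s c, P c -> P (a *: (<< s >> : chain X n) + c)) ->
  forall c, P c.
Proof. exact: freeg_ind. Qed.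

Section EventualVolume.
Context {R : realType} {k : nat}.
Local Notation X := (proper_subset k.+3).
Local Notation e n := (<< vertices R n >> : {freeg (seq 'rV[R]_n.+1) / R}).

Lemma chain_evalD n (w w' : {freeg (seq 'rV[R]_n.+1) / R}) (c : chain X n) a :
  chain_eval (a *: w + w') c = a *: chain_eval w c + chain_eval w' c.
Proof.
elim/chain_ind: c => [|b s c IH]; first by rewrite !linear0 addr0.
rewrite !linearP /= IH !chain_evalU linearP /= !scalerDr !scalerA mulrC.
by rewrite addrACA.
Qed.

Lemma chain_evalB n (w w' : {freeg (seq 'rV[R]_n.+1) / R}) (c : chain X n) :
  chain_eval (w - w') c = chain_eval w c - chain_eval w' c.
Proof. by rewrite addrC -scaleN1r chain_evalD scaleN1r addrC. Qed.

Lemma small_vertices n :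
  exists2 r, True & small_simplex n.+1 (@std_simplex R n) r (vertices R n).
Proof.
exists (\sum_(v <- vertices R n) `|v| + \sum_(v <- vertices R n) `|v|) => //.
have le_sum x : x \in vertices R n -> `|x| <= \sum_(v <- vertices R n) `|v|.
  move=> xv; rewrite (perm_big _ (perm_to_rem xv)) big_cons /= lerDl.
  by apply: sumr_ge0.
split=> [|x xv|x y xv yv]; first exact: size_vertices.
  exact: vertices_simplex.
by apply: le_trans (ler_normB _ _) _; rewrite lerD ?le_sum.
Qed.

Lemma iter_subdivide_sum (V : lmodType R) n l N (a : 'I_l -> R)
    (w : 'I_l -> {freeg (seq V) / R}) :
  iter N (subdivide n) (\sum_(i < l) a i *: w i) =
  \sum_(i < l) a i *: iter N (subdivide n) (w i).
Proof.
elim: N => // N IH; rewrite iterS IH linear_sum; apply: eq_bigr => i _.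
by rewrite iterS linearZ.
Qed.

Definition subdivided_eval N : chain X k.+1 -> R^o :=
  chain_eval (iter N (subdivide k.+2) (e k.+1)).
HB.instance Definition _ N := GRing.Linear.on (subdivided_eval N).

Lemma near_uniform_miss n l (s : @singular_simplex R X n) : l = n.+1 ->
  \forall N \near \oo,
    spanned (uniform_miss (simplex_label s) l) (iter N (subdivide l) (e n)).
Proof. by move=> ->; apply: eventually_uniform_miss (small_vertices n). Qed.

(** The value on a boundary is that of the sign coboundary on the subdivided simplex one dimension
    higher, which vanishes once all small simplices miss a label. How large [N] must be depends on
    the singular simplices in [c]. *)
Lemma subdivided_eval_boundary (c : chain X k.+2) :
  \forall N \near \oo, subdivided_eval N (boundary c) = 0.
Proof.
elim/chain_ind: c => [|a s c IH].
  by apply: nearW => N; rewrite !linear0.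
have := near_uniform_miss s erefl.
move: IH; apply: filterS2 => N IH sN.
rewrite linearP /= linearP /= IH addr0.
rewrite (_ : subdivided_eval N _ = 0) ?scaler0//.
rewrite /subdivided_eval.
have eE : iter N (subdivide k.+2) (bd (e k.+2)) =
    \sum_(i < k.+3) (-1) ^+ i *: map_list (face_row i)
      (iter N (subdivide k.+2) (e k.+1)).
  rewrite bd_vertices iter_subdivide_sum; apply: eq_bigr => i _.
  by rewrite map_list_iter_subdivide.
rewrite (chain_eval_boundary _ eE) chain_evalU -bd_iter_subdivide.
exact: uniform_miss_eval.
Qed.

(** Subdividing once more changes the list chain by the homotopy formula. Its term in [bd u] is a
    sum of face images, so it evaluates on [boundary c], which is 0. *)
Lemma subdivided_evalS (c : chain X k.+1) N : boundary c = 0 ->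
  subdivided_eval N c - subdivided_eval N.+1 c =
  chain_eval (bd (subdivide_htpy k.+2 (iter N (subdivide k.+2) (e k.+1)))) c.
Proof.
move=> c0; rewrite /subdivided_eval iterS; set u := iter N _ _.
rewrite -chain_evalB.
have -> : u - subdivide k.+2 u =
    1 *: bd (subdivide_htpy k.+2 u) + subdivide_htpy k.+1 (bd u).
  by rewrite scale1r bd_subdivide_htpy subrK.
rewrite chain_evalD scale1r.
have uE : subdivide_htpy k.+1 (bd u) =
    \sum_(i < k.+2) (-1) ^+ i *: map_list (face_row i)
      (subdivide_htpy k.+1 (iter N (subdivide k.+1) (e k))).
  rewrite /u bd_iter_subdivide bd_vertices.
  rewrite iter_subdivide_sum linear_sum; apply: eq_bigr => i _.
  by rewrite linearZ map_list_subdivide_htpy map_list_iter_subdivide.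
by rewrite -(chain_eval_boundary c uE) c0 linear0 addr0.
Qed.

(** The homotopy keeps small simplices inside sets missing a label, so the coboundary that remains
    vanishes for large [N]. *)
Lemma subdivided_eval_stable (c : chain X k.+1) : boundary c = 0 ->
  \forall N \near \oo, subdivided_eval N.+1 c = subdivided_eval N c.
Proof.
move=> c0; suff : \forall N \near \oo, chain_eval
    (bd (subdivide_htpy k.+2 (iter N (subdivide k.+2) (e k.+1)))) c = 0.
  by apply: filterS => N cN; apply/esym/eqP; rewrite -subr_eq0 subdivided_evalS// cN.
elim/chain_ind: c {c0} => [|a s c IH]; first by apply: nearW => N; rewrite linear0.
have := near_uniform_miss s erefl.
move: IH; apply: filterS2 => N IH sN.
rewrite linearP /= IH addr0 chain_evalU uniform_miss_eval ?scaler0//.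
by apply: spanned_linear sN => t; apply: uniform_miss_htpy.
Qed.

Definition eventual_value (c : chain X k.+1) (v : R) :=
  \forall N \near \oo, subdivided_eval N c = v.

Lemma eventual_value_unique c v w :
  eventual_value c v -> eventual_value c w -> v = w.
Proof.
by move=> cv cw; have [N [<- <-]] := filter_ex (filterI cv cw).
Qed.

Lemma eventual_valueP a c c' v v' : eventual_value c v -> eventual_value c' v' ->
  eventual_value (a *: c + c') (a * v + v').
Proof. by apply: filterS2 => N cN cN'; rewrite linearP /= cN cN'. Qed.

Lemma eventual_value_boundary (b : chain X k.+2) : eventual_value (boundary b) 0.
Proof. exact: subdivided_eval_boundary. Qed.

Lemma eventual_value_ex (c : chain X k.+1) : boundary c = 0 ->
  exists v, eventual_value c v.
Proof.
move=> /subdivided_eval_stable [N _ cN]; exists (subdivided_eval N c).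
exists N => // M /=; elim: M => [|M IH] NM.
  by move: NM; rewrite leqn0 => /eqP ->.
move: NM; rewrite leq_eqVlt => /predU1P[-> //|NM].
by rewrite cN//= IH.
Qed.

(** The degree; the default 0 is never taken, since every cycle has an eventual value. *)
Definition volume (a : homology R X k.+1) : R :=
  xget 0 [set v | eventual_value (cycle_val (repr a)) v].

Lemma cycle_boundary (z : @Defs.cycle R X k.+1) : boundary (cycle_val z) = 0.
Proof. by case: z => c zc /=; apply/eqP. Qed.

(** The chosen representative differs from [z] by a boundary, whose eventual value is 0. *)
Lemma volumeE (z : @Defs.cycle R X k.+1) v : eventual_value (cycle_val z) v ->
  volume (homology_class z) = v.
Proof.
move=> zv; rewrite /volume.
have [w rw] := eventual_value_ex (cycle_boundary (repr (homology_class z))).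
have := xgetPex 0 (ex_intro _ w rw : exists v, [set v | eventual_value
  (cycle_val (repr (homology_class z))) v] v).
set u := xget _ _ => /= ru.
have /homology_classP[b bE] := homology_classK (homology_class z).
have := eventual_valueP 1 (eventual_value_boundary b) zv.
rewrite bE scale1r subrK mulr0 add0r => rv.
exact: eventual_value_unique ru rv.
Qed.

Lemma volume_linear : linear (volume : homology R X k.+1 -> R^o).
Proof.
move=> c a b; rewrite -(homology_classK a) -(homology_classK b).
have [v av] := eventual_value_ex (cycle_boundary (repr a)).
have [w bw] := eventual_value_ex (cycle_boundary (repr b)).
rewrite (volumeE av) (volumeE bw) -linearP; apply: volumeE.
exact: eventual_valueP.
Qed.

HB.instance Definition _ := GRing.isLinear.Build R (homology R X k.+1) R^o
  *:%R volume volume_linear.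

End EventualVolume.

(** * The fundamental class of the finite sphere *)

Section FundamentalCycle.
Context {R : realType} {k : nat}.
Local Notation X := (proper_subset k.+3).
Local Notation D := (set_type (@std_simplex R k.+2)).
Implicit Types (t : D) (b : 'I_k.+3).

(** The threshold is the average of the barycentric coordinates, so at least one of them is always
    large. *)
Definition large_coords t : {ffun 'I_k.+3 -> bool} :=
  [ffun b => (k.+3)%:R^-1 <= (\val t) ord0 b].

Let is_proper (A : {ffun 'I_k.+3 -> bool}) := [exists b, A b] && [exists b, ~~ A b].

Lemma single_label_proper : is_proper [ffun b => b == ord0].
Proof.
by apply/andP; split; apply/existsP; [exists ord0|exists ord_max]; rewrite ffunE.
Qed.

(* Only meaningful on the boundary of the simplex: at an interior point all
   coordinates may be large, and then the value is junk. *)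
Definition collapse t : X :=
  if pselect (is_proper (large_coords t)) is left pt then exist is_proper _ pt
  else exist is_proper _ single_label_proper.

Lemma collapseE t i b : (\val t) ord0 i = 0 ->
  collapse t b = ((k.+3)%:R^-1 <= (\val t) ord0 b).
Proof.
move=> ti; rewrite /proper_subset_fun /collapse; case: pselect => [pt|[]].
  by rewrite /= ffunE.
have /set_mem [t0 t1] := valP t.
have m0 : 0 < (k.+3)%:R^-1 :> R by rewrite invr_gt0 ltr0n.
apply/andP; split; last by apply/existsP; exists i; rewrite ffunE ti -ltNge.
rewrite -[[exists _, _]]negbK negb_exists; apply/negP => /forallP small.
have : \sum_i (\val t) ord0 i < \sum_(i < k.+3) (k.+3)%:R^-1.
  apply: ltr_sum => [|j _]; last by have := small j; rewrite ffunE -ltNge.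
  by apply/hasP; exists i; rewrite ?mem_index_enum.
by rewrite t1 sumr_const card_ord -[X in _ < X]mulr_natl divff ?ltxx// pnatr_eq0.
Qed.

Lemma face_coord i (t : @std_simplex R k.+1) : (\val (face i t)) ord0 i = 0 :> R.
Proof. by rewrite /= mxE unlift_none. Qed.

Lemma collapse_face_continuous i : continuous (collapse \o face i).
Proof.
apply: proper_subset_continuous => b.
pose f (t : @std_simplex R k.+1) : R := (\val (face i t)) ord0 b.
have cf : continuous f.
  rewrite (_ : f = ((fun v : 'rV[R]_k.+3 => v ord0 b) \o
    (set_val : D -> 'rV[R]_k.+3)) \o face i); last by [].
  move=> t; apply: continuous_comp; first exact: face_continuous.
  apply: continuous_comp; first exact: initial_continuous.
  exact: coord_continuous.
have := closed_ge_fun (c := (k.+3)%:R^-1) cf; congr closed.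
by apply/seteqP; split => t; rewrite /= (collapseE b (face_coord i t)).
Qed.

Definition sphere_simplex i : @singular_simplex R X k.+1 :=
  HB.pack (collapse \o face i)
    (isContinuous.Build _ _ _ (@collapse_face_continuous i)).

Definition sphere_chain : @chain R X k.+1 :=
  \sum_(i < k.+3) (-1) ^+ i *: << sphere_simplex i >>.

(* [collapse] is discontinuous on the simplex, but this partial push-forward
   suffices to transport the identity [boundaryK] for the identity simplex. *)
Definition collapse_chain n : @chain R D n -> @chain R X n :=
  fglift (fun s : singular_simplex D n =>
    if pselect (continuous (collapse \o s)) is left cs
    then << HB.pack (collapse \o s) (isContinuous.Build _ _ _ cs) :
      singular_simplex X n >> else 0 : chain X n).
HB.instance Definition _ n := GRing.Linear.on (@collapse_chain n).

Lemma collapse_chainU n (s : singular_simplex D n) (s' : singular_simplex X n) :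
  (forall u, s' u = collapse (s u)) -> collapse_chain << s >> = << s' >>.
Proof.
move=> ss'; rewrite /collapse_chain liftU scale1r; case: pselect => [cs|[]].
  by congr << _ >>; apply/continuousEP => u; rewrite ss'.
have -> : collapse \o s = s' by apply/funext => u; rewrite /= ss'.
exact: cts_fun.
Qed.

Lemma sphere_chain_cycle : boundary sphere_chain = 0.
Proof.
pose id_simplex : singular_simplex D k.+2 := idfun.
have faceE i : << sphere_simplex i >> =
    collapse_chain << (id_simplex \o face i : singular_simplex D k.+1) >>.
  by rewrite (@collapse_chainU _ _ (sphere_simplex i)).
rewrite -[RHS](linear0 (@collapse_chain k)).
rewrite -(boundaryK (<< id_simplex >> : chain D k.+2)) /= {3}/boundary_succ.
rewrite liftU scale1r !linear_sum /=; apply: eq_bigr => i _.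
rewrite !linearZ /=; congr (_ *: _).
rewrite /boundary_succ !liftU !scale1r linear_sum; apply: eq_bigr => j _.
rewrite linearZ /=; congr (_ *: _); apply/esym/collapse_chainU => t.
by [].
Qed.

(** On face [i] the coordinate [i] is 0, hence never large. *)
Lemma label_sphere_simplex i (v : 'rV[R]_k.+2) : std_simplex v ->
  simplex_label (sphere_simplex i) v != i.
Proof.
move=> Sv; rewrite /simplex_label; case: pselect => // Sv'.
apply/eqP => vi; have := pick_labelP (sphere_simplex i (SigSub (mem_set Sv'))).
rewrite vi (collapseE _ (face_coord i _)) face_coord leNgt invr_gt0 ltr0n.
by [].
Qed.

Lemma label_sphere_vertex i (j : 'I_k.+2) :
  simplex_label (sphere_simplex i) (delta_mx ord0 j) = fintype.lift i j.
Proof.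
rewrite /simplex_label; case: pselect => [Sv|[]]; last first.
  by apply: vertices_simplex; apply: map_f; rewrite mem_enum.
set t := SigSub _; have := pick_labelP (sphere_simplex i t).
rewrite (collapseE _ (face_coord i _)) /= face_row_vertex mxE eqxx /=.
by case: eqP => //= _; rewrite leNgt invr_gt0 ltr0n.
Qed.

(** Face [i] as a whole misses the label [i], so the value is the same for every [N] and can be
    computed without subdivision. *)
Lemma subdivided_eval_sphere_chain N : subdivided_eval N sphere_chain = 1.
Proof.
elim: N => [|N <-]; last first.
  apply/esym/eqP; rewrite -subr_eq0 (subdivided_evalS _ sphere_chain_cycle).
  rewrite linear_sum big1 // => i _; rewrite linearZ /= chain_evalU.
  rewrite uniform_miss_eval ?scaler0//.
  have vi : uniform_miss (simplex_label (sphere_simplex i)) k.+2 (vertices R k.+1).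
    exists i, (@std_simplex R k.+1); split; first exact: std_simplex_bary_closed.
      by split; [exact: size_vertices|exact: vertices_simplex].
    by move=> v; apply: label_sphere_simplex.
  pose miss := uniform_miss (simplex_label (sphere_simplex i)) k.+2.
  suff : spanned miss (iter N (subdivide k.+2) << vertices R k.+1 >>).
    by apply: spanned_linear => s; apply: uniform_miss_htpy.
  elim: N => [|N IH]; first exact: spannedU.
  by apply: spanned_linear IH => s; apply: uniform_miss_subdivide.
rewrite /subdivided_eval linear_sum /=.
under eq_bigr => i _ do rewrite linearZ /= chain_evalU label_evalU.
have labelE i : label_det (map (simplex_label (sphere_simplex i)) (vertices R k.+1))
    = \det (\matrix_(a < k.+2, b < k.+2)
        (fintype.lift i a == fintype.lift ord0 b)%:R) :> R.
  congr (\det _); apply/matrixP => a b; rewrite !mxE; congr (_ == _)%:R.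
  rewrite (nth_map 0) ?size_vertices// nth_vertices// label_sphere_vertex.
  by congr fintype.lift; apply/val_inj; rewrite /= inordK.
(* Face 0 carries the nonzero labels in increasing order and gives the identity matrix; any other
   face [i] misses the nonzero label [i], which gives a zero column. *)
rewrite (bigD1 ord0) //= big1 ?addr0 => [|i i0].
  rewrite labelE expr0 scale1r -[RHS](det1 R k.+2); congr (\det _).
  by apply/matrixP => a b; rewrite !mxE (inj_eq (@fintype.lift_inj _ _)).
have [b bi] : exists b : 'I_k.+2, i = fintype.lift ord0 b.
  by case: (unliftP ord0 i) i0 => [b ->|-> //]; exists b.
rewrite labelE (expand_det_col _ b) big1 ?scaler0// => a _.
by rewrite mxE -bi eq_sym (negPf (fintype.neq_lift _ _)) mul0r.
Qed.

Lemma sphere_chain_is_cycle : sphere_chain \in @is_cycle R X k.+1.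
Proof. by apply/eqP; exact: sphere_chain_cycle. Qed.

Definition sphere_class : homology R X k.+1 :=
  homology_class (Cycle sphere_chain_is_cycle).

Lemma volume_sphere_class : volume sphere_class = 1.
Proof.
by apply: volumeE; apply: nearW => N; exact: subdivided_eval_sphere_chain.
Qed.

End FundamentalCycle.

(** * The semi-norm defined by maps to a fixed space *)

Section MappingSeminorm.
Context {R : realType} {d : nat} {Y : topologicalType} (y0 : Y).
Variable phi : {linear homology R Y d -> R^o}.

Definition mapping_seminorm (X : topologicalType) (a : homology R X d) : \bar R :=
  ereal_sup [set `|phi (homology_map f a)|%:E | f in [set: continuousType X Y]].

Lemma mapping_seminorm_ub (X : topologicalType) (a : homology R X d)
    (f : continuousType X Y) :
  (`|phi (homology_map f a)|%:E <= mapping_seminorm a)%E.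
Proof. by apply: ereal_sup_ubound; exists f. Qed.

Lemma mapping_seminorm_le (X : topologicalType) (a : homology R X d) (u : \bar R) :
  (forall f : continuousType X Y, `|phi (homology_map f a)|%:E <= u)%E ->
  (mapping_seminorm a <= u)%E.
Proof. by move=> fu; apply: ge_ereal_sup => _ [f _ <-]. Qed.

(** The constant map at [y0] shows that the supremum is not over the empty set, where it would be
    [-oo]. *)
Lemma mapping_seminorm_ge0 X (a : homology R X d) : (0 <= mapping_seminorm a)%E.
Proof.
apply: le_trans (mapping_seminorm_ub a (cst y0)).
by rewrite lee_fin.
Qed.

Lemma mapping_seminorm0 X : mapping_seminorm (0 : homology R X d) = 0%E.
Proof.
apply/eqP; rewrite eq_le mapping_seminorm_ge0 andbT.
by apply: mapping_seminorm_le => f; rewrite !linear0 normr0.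
Qed.

Lemma mapping_seminormZ_le X (c : R) (a : homology R X d) :
  (mapping_seminorm (c *: a) <= `|c|%:E * mapping_seminorm a)%E.
Proof.
apply: mapping_seminorm_le => f; rewrite !linearZ /= normrM EFinM.
by apply: lee_wpmul2l; [rewrite lee_fin|exact: mapping_seminorm_ub].
Qed.

Lemma mapping_seminormZ X (c : R) (a : homology R X d) : c != 0 ->
  mapping_seminorm (c *: a) = (`|c|%:E * mapping_seminorm a)%E.
Proof.
move=> c0; apply/eqP; rewrite eq_le mapping_seminormZ_le /=.
(* The reverse inequality is the one just used, for the scalar [c^-1] and the class [c *: a]. *)
have /(lee_wpmul2l (x := `|c|%:E)) := mapping_seminormZ_le c^-1 (c *: a).
rewrite scalerA mulVf// scale1r muleA -EFinM normfV divff ?normr_eq0// mul1e.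
by apply; rewrite lee_fin.
Qed.

Lemma mapping_seminormD X (a b : homology R X d) :
  (mapping_seminorm (a + b)%R <= mapping_seminorm a + mapping_seminorm b)%E.
Proof.
apply: mapping_seminorm_le => f; rewrite !linearD.
apply: le_trans (leeD (mapping_seminorm_ub a f) (mapping_seminorm_ub b f)).
by rewrite -EFinD lee_fin ler_normD.
Qed.

(** Maps from [X'] to [Y] precomposed with [f] are among the maps from [X] to [Y]. *)
Lemma mapping_seminorm_map (X X' : topologicalType) (f : continuousType X X') (a : homology R X d) :
  (mapping_seminorm (homology_map f a) <= mapping_seminorm a)%E.
Proof.
apply: mapping_seminorm_le => g; rewrite -homology_map_comp.
exact: mapping_seminorm_ub.
Qed.

Definition mapping_functorial_seminorm : functorial_seminorm R d :=
  FunctorialSeminorm mapping_seminorm_ge0 mapping_seminorm0 mapping_seminormZ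
    mapping_seminormD mapping_seminorm_map.

Lemma mapping_seminorm_pos (a : homology R Y d) :
  phi a != 0 -> (0 < mapping_seminorm a)%E.
Proof.
move=> pa; apply: lt_le_trans (mapping_seminorm_ub a idfun).
by rewrite homology_map_id lte_fin normr_gt0.
Qed.

End MappingSeminorm.

(* A finite space has finitely many self-maps. *)
Lemma mapping_seminorm_finite (R : realType) d n
    (phi : {linear homology R (proper_subset n) d -> R^o}) (a : homology R (proper_subset n) d) :
  (mapping_seminorm phi a < +oo)%E.
Proof.
pose X := proper_subset n.
(* The supremum is bounded by a sum over the finitely many functions, where discontinuous ones count
   0. *)
pose v (F : {ffun X -> X}) : R := if pselect (continuous F) is left cF
  then `|phi (homology_map (HB.pack (F : X -> X) (isContinuous.Build X X F cF)) a)|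
  else 0.
apply: le_lt_trans (ltry (\sum_F v F)).
apply: mapping_seminorm_le => f; rewrite lee_fin.
rewrite (bigD1 [ffun x => f x]) //= -[leLHS]addr0 lerD ?sumr_ge0// => [|F _]; last first.
  by rewrite /v; case: pselect.
rewrite /v; case: pselect => [cF|[]].
  rewrite le_eqVlt; apply/predU1P; left; congr `|phi (homology_map _ a)|.
  by apply/continuousEP => x; rewrite /= ffunE.
rewrite (_ : ([ffun x => f x] : X -> X) = f); first exact: cts_fun.
by apply/funext => x; rewrite ffunE.
Qed.

Theorem corollary1p6 (R : realType) (n : nat) (n_gt1 : (1 < n)%N) :
  exists N : functorial_seminorm R (415 + 160 * n)%N,
  exists (X : topologicalType) (a : homology R X (415 + 160 * n)%N),
    simply_connected R X /\ (0 < N X a < +oo)%E.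
Proof.
(* In degree [k.+2] the model of the sphere has [k.+4] labels, more than the three that simple
   connectivity has to exceed. *)
have [k ->] : exists k, (415 + 160 * n)%N = k.+2.
  by exists (413 + 160 * n)%N; rewrite -!addSn.
have [y0] : inhabited (proper_subset k.+4).
  by have [[]] := @proper_subset_simply_connected R k.+4 isT.
exists (mapping_functorial_seminorm y0 volume), (proper_subset k.+4), sphere_class.
split; first exact: proper_subset_simply_connected.
rewrite mapping_seminorm_finite andbT; apply: mapping_seminorm_pos.
by rewrite [X in X != _]volume_sphere_class oner_neq0.
Qed.
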